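(* Let $N_0$ be a positive integer and let $\{M_N\}_{N\geq N_0}$ be positive integers with $\lim_{N\to\infty}M_N=\infty$. For each $N\geq N_0$, let $\mathbf{r}^{(N)}\in\mathbb{R}^{M_N}$ and $\mathbf{c}^{(N)}\in\mathbb{R}^N$ be positive vectors with $\Vert\mathbf{r}^{(N)}\Vert_1=\Vert\mathbf{c}^{(N)}\Vert_1$, let $\widetilde{A}^{(N)}\in\mathbb{R}^{M_N\times N}$ be a positive random matrix, and let $A^{(N)}=\mathbb{E}[\widetilde{A}^{(N)}]$. Let $\widetilde{P}^{(N)}$ and $P^{(N)}$ be the (uniquely determined) matrices obtained from $\widetilde{A}^{(N)}$ and $A^{(N)}$, respectively, by scaling them to row sums $\mathbf{r}^{(N)}$ and column sums $\mathbf{c}^{(N)}$. Suppose that for each index $N$ the entries of $\widetilde{A}^{(N)}$ are independent, and that $\widetilde{A}^{(N)}_{i,j}\in[a,b]$ almost surely for all $i\in[M_N]$, $j\in[N]$, and some universal positive constants $a,b$ (independent of $N$). Suppose in addition that $\max_i r_i^{(N)}/\min_i r_i^{(N)}\leq C$ and $\max_j c_j^{(N)}/\min_j c_j^{(N)}\leq C$ for all indices $N$ and some universal constant $C$ (independent of $N$). Then $$\frac{\Vert\widetilde{P}^{(N)}-P^{(N)}\Vert_2}{\Vert P^{(N)}\Vert_2}=\mathcal{O}_{\text{w.h.p}}\left(\sqrt{\frac{\log(\max\{M_N,N\})}{\min\{M_N,N\}}}\right).$$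
   Context: $[n]=\{1,\ldots,n\}$. A matrix or vector is positive if all its entries are strictly positive. A pair of vectors $(\mathbf{x},\mathbf{y})$ scales a matrix $B\in\mathbb{R}^{M\times N}$ to row sums $\mathbf{r}$ and column sums $\mathbf{c}$ if $\sum_{j=1}^N x_iB_{i,j}y_j=r_i$ for all $i\in[M]$ and $\sum_{i=1}^M x_iB_{i,j}y_j=c_j$ for all $j\in[N]$. For positive $B,\mathbf{r},\mathbf{c}$ with $\Vert\mathbf{r}\Vert_1=\Vert\mathbf{c}\Vert_1$, a positive scaling pair exists, is unique up to replacing $(\mathbf{x},\mathbf{y})$ by $(\alpha\mathbf{x},\alpha^{-1}\mathbf{y})$ with $\alpha>0$, and the scaled matrix $D(\mathbf{x})BD(\mathbf{y})$ is therefore unique, where $D(\mathbf{v})$ is the diagonal matrix with $\mathbf{v}$ on its main diagonal. Thus $\widetilde{P}^{(N)}=D(\widetilde{\mathbf{x}}^{(N)})\widetilde{A}^{(N)}D(\widetilde{\mathbf{y}}^{(N)})$ and $P^{(N)}=D(\mathbf{x}^{(N)})A^{(N)}D(\mathbf{y}^{(N)})$ for any positive pairs scaling $\widetilde{A}^{(N)}$, respectively $A^{(N)}$, to row sums $\mathbf{r}^{(N)}$ and column sums $\mathbf{c}^{(N)}$. $\Vert\cdot\Vert_2$ on matrices is the operator (spectral) norm. For a sequence of random variables $X_N$ and a deterministic sequence $\gamma_N$, $X_N=\mathcal{O}_{\text{w.h.p}}(\gamma_N)$ means that there exists a constant $C'$ (independent of $N$) with $\lim_{N\to\infty}\Pr\{X_N\leq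 C'\gamma_N\}=1$. *)

(* Defs.v *)
From HB Require Import structures.
From mathcomp Require Import all_boot all_order all_algebra.
From mathcomp Require Import all_classical all_reals all_analysis.

Set Implicit Arguments.
Unset Strict Implicit.
Unset Printing Implicit Defensive.

Import Order.TTheory GRing.Theory Num.Theory.
Import numFieldNormedType.Exports.

Local Open Scope classical_set_scope.
Local Open Scope ring_scope.

Definition positive_mx (R : realType) (m n : nat) (B : 'M[R]_(m, n)) : Prop :=
  forall i j, 0 < B i j.

Definition l1norm (R : realType) (n : nat) (v : 'rV[R]_n) : R :=
  \sum_(i < n) `|v 0 i|.

Definition l2norm (R : realType) (n : nat) (v : 'cV[R]_n) : R :=
  Num.sqrt (\sum_(i < n) v i 0 ^+ 2).

(* The library's norm `|B| on matrices is the entrywise sup norm, hence this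
   separate definition of the norm induced by the Euclidean norms. *)
Definition opnorm2 (R : realType) (m n : nat) (B : 'M[R]_(m, n)) : R :=
  sup [set l2norm (B *m v) | v in [set v : 'cV[R]_n | l2norm v <= 1]].

(* Largest and smallest entry: the range is finite, so for n > 0 the supremum
   and the infimum are attained. *)
Definition max_entry (R : realType) (n : nat) (v : 'rV[R]_n) : R :=
  sup (range (v 0)).

Definition min_entry (R : realType) (n : nat) (v : 'rV[R]_n) : R :=
  inf (range (v 0)).

Definition scales (R : realType) (m n : nat) (x : 'rV[R]_m) (y : 'rV[R]_n)
    (B : 'M[R]_(m, n)) (r : 'rV[R]_m) (c : 'rV[R]_n) : Prop :=
  (forall i, \sum_(j < n) x 0 i * B i j * y 0 j = r 0 i) /\
  (forall j, \sum_(i < m) x 0 i * B i j * y 0 j = c 0 j).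

(* For positive B, r, c with l1norm r = l1norm c there is exactly one such Q. *)
Definition is_scaling_of (R : realType) (m n : nat) (B : 'M[R]_(m, n))
    (r : 'rV[R]_m) (c : 'rV[R]_n) (Q : 'M[R]_(m, n)) : Prop :=
  exists (x : 'rV[R]_m) (y : 'rV[R]_n),
    [/\ positive_mx x, positive_mx y, scales x y B r c &
        Q = diag_mx x *m B *m diag_mx y].

(* Mutual independence: the product rule for every subfamily J of the finite
   family X and all Borel sets. *)
Definition mutually_independent (R : realType) (d : measure_display)
    (T : measurableType d) (P : probability T R) (I : finType)
    (X : I -> {RV P >-> R}) : Prop :=
  forall (J : {set I}) (B : I -> set R),
    (forall i, measurable (B i)) ->
    P (\bigcap_(i in [set` J]) (X i @^-1` B i)) =
    (\prod_(i in J) P (X i @^-1` B i))%E.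

Definition sample_mx (R : realType) (d : measure_display)
    (T : measurableType d) (P : probability T R) (m n : nat)
    (X : 'I_m -> 'I_n -> {RV P >-> R}) (w : T) : 'M[R]_(m, n) :=
  \matrix_(i < m, j < n) X i j w.

Definition expect_mx (R : realType) (d : measure_display)
    (T : measurableType d) (P : probability T R) (m n : nat)
    (X : 'I_m -> 'I_n -> {RV P >-> R}) : 'M[R]_(m, n) :=
  \matrix_(i < m, j < n) fine ('E_P[X i j])%E.

(* The N-th variable may live on its own probability space. *)
Definition bigO_whp (R : realType) (d : nat -> measure_display)
    (T : forall N, measurableType (d N)) (P : forall N, probability (T N) R)
    (X : forall N, T N -> R) (gamma : nat -> R) : Prop :=
  exists C' : R,
    P N [set w : T N | X N w <= C' * gamma N] @[N --> \oo] --> 1%:E.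

(* Main.v *)
Require Import Defs.
From HB Require Import structures.
From mathcomp Require Import all_boot all_order all_algebra.
From mathcomp Require Import all_classical all_reals all_analysis.
From mathcomp Require Import measurable_realfun.
From mathcomp Require Import ring lra zify.

(* Write Pt = D(x')AtD(y') and compare it with Ah = D(x)AtD(y), where (x, y)
   scales the mean matrix A. With z_ij = ln (x'_i/x_i) + ln (y'_j/y_j) we have
   Pt_ij = Ah_ij e^(z_ij), and since Pt and P have the same marginals,
   <Pt - Ah, z> = - <G, z> with G = D(x)(At - A)D(y). All z_ij are bounded, so the
   left side dominates a multiple of |z|_F^2, while z has rank two, so the right
   side is at most 2 |G| |z|_F. Hence the Frobenius norm of Pt - Ah, and so the
   operator norm of Pt - P, is O(|G|).

   The operator norm of At - A is O(sqrt (h ln h)), h = max (M, N), by a union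
   bound over a cubic grid: the logarithm in the claim leaves room for a grid with
   h^O(h) points. Rounding the entries to multiples of 1/h turns independence into
   a product formula for finite sums, from which Hoeffding's bound follows.

   The same stability estimate, for fixed matrices, shows that the scaled
   matrix depends continuously on the matrix, which makes the event in the claim
   measurable. *)

Set Implicit Arguments.
Unset Strict Implicit.
Unset Printing Implicit Defensive.

Import Order.TTheory GRing.Theory Num.Theory.
Import numFieldNormedType.Exports.

Local Open Scope classical_set_scope.
Local Open Scope ring_scope.

(** * Bilinear forms and the operator norm *)

(** Over an arbitrary finite index type, so that one notion gives both Euclidean norms of vectors
    and, over index pairs, Frobenius norms. *)
Definition euclid (R : realType) (I : finType) (f : I -> R) : R :=
  Num.sqrt (\sum_i f i ^+ 2).

(** Supremum-free form of a bound on the operator norm. One side suffices, since [p] may be replaced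
    by [- p]. *)
Definition bilin_le (R : realType) (m n : nat) (B : 'M[R]_(m, n)) (e : R) :=
  forall (p : 'I_m -> R) (q : 'I_n -> R),
    \sum_i \sum_j p i * q j * B i j <= e * (euclid p * euclid q).

Lemma sumr_sqr_ge0 (R : realType) (I : finType) (f : I -> R) :
  0 <= \sum_i f i ^+ 2.
Proof. by apply: sumr_ge0 => i _; exact: sqr_ge0. Qed.

Lemma euclid_ge0 (R : realType) (I : finType) (f : I -> R) : 0 <= euclid f.
Proof. exact: sqrtr_ge0. Qed.

Lemma euclid_sqr (R : realType) (I : finType) (f : I -> R) :
  euclid f ^+ 2 = \sum_i f i ^+ 2.
Proof. by rewrite sqr_sqrtr// sumr_sqr_ge0. Qed.

Lemma euclidZ (R : realType) (I : finType) (k : R) (f : I -> R) :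
  0 <= k -> euclid (fun i => k * f i) = k * euclid f.
Proof.
move=> k0; rewrite /euclid.
under eq_bigr do rewrite exprMn.
by rewrite -mulr_sumr sqrtrM ?sqr_ge0// sqrtr_sqr ger0_norm.
Qed.

Lemma euclid_le (R : realType) (I : finType) (f g : I -> R) :
  (forall i, `|f i| <= g i) -> euclid f <= euclid g.
Proof.
move=> fg; rewrite ler_sqrt ?sumr_sqr_ge0//; apply: ler_sum => i _.
by rewrite -real_normK ?num_real// lerXn2r ?nnegrE ?normr_ge0//; apply: le_trans (fg i).
Qed.

Lemma euclid_le_const (R : realType) (I : finType) (f : I -> R) (k : R) :
  (forall i, `|f i| <= k) -> euclid f <= k * Num.sqrt #|I|%:R.
Proof.
move=> fk; have [/eqP I0|] := boolP (#|I| == 0%N).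
  rewrite /euclid big1 ?sqrtr0 ?I0 ?sqrtr0 ?mulr0// => i _.
  by have := fintype0 i I0.
rewrite -lt0n => /card_gt0P[i0 _].
have k0 : 0 <= k by apply: le_trans (fk i0).
rewrite (le_trans (euclid_le fk))// /euclid sumr_const -[_ *+ #|_|]mulr_natr.
by rewrite sqrtrM ?sqr_ge0// sqrtr_sqr ger0_norm.
Qed.

Lemma cauchy_schwarz (R : realType) (I : finType) (f g : I -> R) :
  \sum_i f i * g i <= euclid f * euclid g.
Proof.
have sq : (\sum_i f i * g i) ^+ 2 <= (euclid f * euclid g) ^+ 2.
  rewrite exprMn !euclid_sqr.
  (* Lagrange's identity: this sum is twice the gap between the two sides. *)
  have : 0 <= \sum_i \sum_j (f i * g j - f j * g i) ^+ 2.
    by apply: sumr_ge0 => i _; exact: sumr_sqr_ge0.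
  have E i j : (f i * g j - f j * g i) ^+ 2 =
      f i ^+ 2 * g j ^+ 2 + g i ^+ 2 * f j ^+ 2
      - 2 * (f i * g i) * (f j * g j) by ring.
  under eq_bigr do under eq_bigr do rewrite E.
  under eq_bigr do rewrite sumrB big_split/= -!mulr_sumr.
  rewrite sumrB big_split/= -!mulr_suml -mulr_sumr.
  rewrite [X in _ + X - _]mulrC; lra.
apply: le_trans (ler_norm _) _.
rewrite -(@ler_pXn2r _ 2)// ?nnegrE ?mulr_ge0 ?euclid_ge0//.
by rewrite real_normK ?num_real.
Qed.

Lemma euclid_pair (R : realType) (I J : finType) (f : I -> R) (g : J -> R) :
  euclid (fun ij : I * J => f ij.1 * g ij.2) = euclid f * euclid g.
Proof.
rewrite /euclid -sqrtrM ?sumr_sqr_ge0//; congr Num.sqrt.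
rewrite -(pair_bigA _ (fun i j => (f i * g j) ^+ 2))/= mulr_suml.
by apply: eq_bigr => i _; rewrite mulr_sumr; apply: eq_bigr => j _; rewrite exprMn.
Qed.

Lemma bilin_le_frobenius (R : realType) (m n : nat) (B : 'M[R]_(m, n)) :
  bilin_le B (euclid (fun ij : 'I_m * 'I_n => B ij.1 ij.2)).
Proof.
move=> p q; rewrite pair_big/= mulrC -euclid_pair.
exact: (cauchy_schwarz (fun ij => p ij.1 * q ij.2)).
Qed.

Lemma bilin_le_entry (R : realType) (m n : nat) (B : 'M[R]_(m, n)) (k : R) :
  (forall i j, `|B i j| <= k) -> bilin_le B (k * Num.sqrt (m * n)%:R).
Proof.
move=> Bk p q; apply: le_trans (bilin_le_frobenius B p q) _.
apply: ler_wpM2r; first by rewrite mulr_ge0 ?euclid_ge0.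
rewrite -[in leRHS](card_ord m) -[in leRHS](card_ord n) -card_prod.
by apply: euclid_le_const => -[i j]; exact: Bk.
Qed.

Lemma bilin_leD (R : realType) (m n : nat) (B B' : 'M[R]_(m, n)) (e e' : R) :
  bilin_le B e -> bilin_le B' e' -> bilin_le (B + B') (e + e').
Proof.
move=> Be Be' p q; rewrite mulrDl; apply: le_trans (lerD (Be p q) (Be' p q)).
rewrite -big_split/=; apply: ler_sum => i _; rewrite -big_split/=.
by apply: ler_sum => j _; rewrite mxE mulrDr.
Qed.

Lemma bilin_le_opp (R : realType) (m n : nat) (B : 'M[R]_(m, n)) (e : R) :
  bilin_le B e -> bilin_le (- B) e.
Proof.
move=> Be p q; have := Be (fun i => - p i) q.
rewrite (_ : euclid (fun i => - p i) = euclid p); last first.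
  by rewrite /euclid; under eq_bigr do rewrite sqrrN.
apply: le_trans; apply: ler_sum => i _; apply: ler_sum => j _.
by rewrite mxE mulrN !mulNr.
Qed.

Lemma l2normE (R : realType) (n : nat) (v : 'cV[R]_n) :
  l2norm v = euclid (fun i => v i 0).
Proof. by []. Qed.

Lemma bilin_mulmx (R : realType) (m n : nat) (B : 'M[R]_(m, n))
    (u : 'cV[R]_m) (v : 'cV[R]_n) :
  \sum_i \sum_j u i 0 * v j 0 * B i j = \sum_i u i 0 * (B *m v) i 0.
Proof.
apply: eq_bigr => i _; rewrite mxE mulr_sumr; apply: eq_bigr => j _; ring.
Qed.

(** Test the form with [B *m v] on the left and [v] on the right, then cancel one factor
    [l2norm (B *m v)]. *)
Lemma bilin_le_mulmx (R : realType) (m n : nat) (B : 'M[R]_(m, n)) (e : R)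
    (v : 'cV[R]_n) :
  0 <= e -> bilin_le B e -> l2norm (B *m v) <= e * l2norm v.
Proof.
move=> e0 Be; have := Be (fun i => (B *m v) i 0) (fun j => v j 0).
rewrite bilin_mulmx -!l2normE.
under eq_bigr do rewrite -expr2.
rewrite -euclid_sqr -l2normE expr2 mulrCA.
have [->|nz] := eqVneq (l2norm (B *m v)) 0.
  by rewrite mulr_ge0// l2normE euclid_ge0.
by rewrite ler_pM2l// lt_def nz l2normE euclid_ge0.
Qed.

(** The Frobenius norm bounds the set, so the [sup] in [opnorm2] is a genuine least upper bound. *)
Lemma opnorm2_has_sup (R : realType) (m n : nat) (B : 'M[R]_(m, n)) :
  has_sup [set l2norm (B *m v) | v in [set v : 'cV[R]_n | l2norm v <= 1]].
Proof.
split.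
  exists (l2norm (B *m 0)), 0 => //=; rewrite /l2norm big1 ?sqrtr0//.
  by move=> i _; rewrite mxE expr0n.
exists (euclid (fun ij : 'I_m * 'I_n => B ij.1 ij.2)) => _ [v /= v1 <-].
apply: le_trans (bilin_le_mulmx v _ (bilin_le_frobenius B)) _.
  exact: euclid_ge0.
by rewrite ler_piMr ?euclid_ge0.
Qed.

Lemma opnorm2_le (R : realType) (m n : nat) (B : 'M[R]_(m, n)) (e : R) :
  0 <= e -> bilin_le B e -> opnorm2 B <= e.
Proof.
move=> e0 Be; apply: ge_sup; first by case: (opnorm2_has_sup B).
move=> _ [v /= v1 <-]; apply: le_trans (bilin_le_mulmx v e0 Be) _.
by rewrite ler_piMr.
Qed.

Lemma opnorm2_bilin_le (R : realType) (m n : nat) (B : 'M[R]_(m, n)) :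
  bilin_le B (opnorm2 B).
Proof.
move=> p q; pose u : 'cV[R]_m := \col_i p i; pose v : 'cV[R]_n := \col_j q j.
have -> : \sum_i \sum_j p i * q j * B i j =
          \sum_i \sum_j u i 0 * v j 0 * B i j.
  by apply: eq_bigr => i _; apply: eq_bigr => j _; rewrite !mxE.
rewrite bilin_mulmx; apply: le_trans (cauchy_schwarz _ _) _.
rewrite -l2normE (_ : euclid p = l2norm u); last first.
  by congr Num.sqrt; apply: eq_bigr => i _; rewrite mxE.
rewrite (_ : euclid q = l2norm v); last first.
  by congr Num.sqrt; apply: eq_bigr => i _; rewrite mxE.
rewrite -l2normE mulrCA; apply: ler_wpM2l; first exact: euclid_ge0.
(* A null vector cannot be normalised; the Frobenius bound shows directly that its image has norm
   zero. *)
have [v0|vn0] := eqVneq (l2norm v) 0.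
  rewrite v0 mulr0 -(mulr0 (euclid (fun ij : 'I_m * 'I_n => B ij.1 ij.2))) -v0.
  by apply: bilin_le_mulmx (bilin_le_frobenius B); exact: euclid_ge0.
have v0 : 0 < l2norm v by rewrite lt_def vn0 l2normE euclid_ge0.
have sZ k (w : 'cV[R]_n) : 0 <= k -> l2norm (B *m (k *: w)) = k * l2norm (B *m w).
  move=> k0; rewrite -scalemxAr !l2normE -euclidZ//; congr Num.sqrt.
  by apply: eq_bigr => i _; rewrite mxE.
have iv0 : 0 <= (l2norm v)^-1 by rewrite invr_ge0 ltW.
rewrite -ler_pdivrMr// mulrC -sZ//.
apply: (ub_le_sup (proj2 (opnorm2_has_sup B))).
exists ((l2norm v)^-1 *: v) => //=.
rewrite l2normE (_ : euclid _ = euclid (fun i => (l2norm v)^-1 * v i 0)).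
  by rewrite euclidZ// -l2normE mulVf.
by congr Num.sqrt; apply: eq_bigr => i _; rewrite mxE.
Qed.

Lemma opnorm2_ge0 (R : realType) (m n : nat) (B : 'M[R]_(m, n)) :
  0 <= opnorm2 B.
Proof.
apply: (@le_trans _ _ (l2norm (B *m 0))); first exact: sqrtr_ge0.
apply: (ub_le_sup (proj2 (opnorm2_has_sup B))).
exists 0 => //=; rewrite /l2norm big1 ?sqrtr0//.
by move=> i _; rewrite mxE expr0n.
Qed.

Lemma opnorm2D (R : realType) (m n : nat) (B B' : 'M[R]_(m, n)) :
  opnorm2 (B + B') <= opnorm2 B + opnorm2 B'.
Proof.
apply: opnorm2_le; first by rewrite addr_ge0 ?opnorm2_ge0.
by apply: bilin_leD; exact: opnorm2_bilin_le.
Qed.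

(** * Stability of matrix scaling *)

Lemma ln_le_sub1 (R : realType) (t : R) : 0 < t -> ln t <= t - 1.
Proof.
move=> t0; have := @le_ln1Dx R (t - 1).
by rewrite (_ : 1 + (t - 1) = t); [apply; lra|ring].
Qed.

Lemma ln_ge_1sub (R : realType) (t : R) : 0 < t -> t - 1 <= t * ln t.
Proof.
move=> t0; have := @ln_le_sub1 R t^-1; rewrite invr_gt0 lnV// => /(_ t0) h.
have := ler_wpM2l (ltW t0) h; rewrite mulrBr mulfV ?gt_eqF//; lra.
Qed.

(** The logarithmic mean [(t - 1) / ln t] of 1 and [t] lies in [[1/K, K]] when [t] does; this
    follows from [ln t <= t - 1 <= t * ln t]. *)
Lemma ln_compare_sub1 (R : realType) (K t : R) :
  0 < t -> 1 <= K -> 1 <= K * t -> t <= K ->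
  ln t ^+ 2 <= K * ((t - 1) * ln t) /\ `|t - 1| <= K * `|ln t|.
Proof.
move=> t0 K1 tK Kt; have l1 := ln_le_sub1 t0; have l2 := ln_ge_1sub t0.
have [t1|t1] := leP 1 t.
  have l0 : 0 <= ln t by rewrite ln_ge0.
  rewrite !ger0_norm ?subr_ge0//; split; nra.
have l0 : ln t < 0 by lra.
rewrite !ltr0_norm ?subr_lt0//; split; last by nra.
have h : - ln t <= K * (1 - t).
  have : K * (t - 1) <= K * t * ln t by rewrite -mulrA ler_wpM2l// (le_trans _ K1).
  by nra.
nra.
Qed.

Lemma diag_scaling_entry (R : realType) (m n : nat) (x : 'rV[R]_m)
    (y : 'rV[R]_n) (B : 'M[R]_(m, n)) i j :
  (diag_mx x *m B *m diag_mx y) i j = x 0 i * y 0 j * B i j.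
Proof. by rewrite mul_mx_diag mxE mul_diag_mx mxE mulrAC. Qed.

Lemma bilin_le_diag (R : realType) (m n : nat) (x : 'rV[R]_m)
    (y : 'rV[R]_n) (B : 'M[R]_(m, n)) (e h : R) :
  0 <= e -> 0 <= h -> (forall i j, `|x 0 i * y 0 j| <= h) -> bilin_le B e ->
  bilin_le (diag_mx x *m B *m diag_mx y) (e * h).
Proof.
move=> e0 h0 xyh Be p q.
have -> : \sum_i \sum_j p i * q j * (diag_mx x *m B *m diag_mx y) i j =
    \sum_i \sum_j (x 0 i * p i) * (y 0 j * q j) * B i j.
  apply: eq_bigr => i _; apply: eq_bigr => j _.
  by rewrite diag_scaling_entry; ring.
(* Only the products [x_i y_j] are bounded, not the factors, so the two norms are merged into one
   norm over index pairs. *)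
apply: le_trans (Be _ _) _; rewrite -mulrA ler_wpM2l// -!euclid_pair -euclidZ//.
rewrite /euclid ler_sqrt ?sumr_sqr_ge0//; apply: ler_sum => -[i j] _ /=.
rewrite mulrACA 2!exprMn [in leRHS]exprMn.
rewrite -exprMn ler_wpM2r ?sqr_ge0// -real_normK ?num_real//.
by rewrite lerXn2r ?nnegrE ?normr_ge0.
Qed.

(** The cross term is twice the product of the two sums, which vanishes for centred [u]. *)
Lemma sum_rank2_sqr (R : realType) (m n : nat) (u : 'I_m -> R) (v : 'I_n -> R) :
  \sum_i u i = 0 ->
  \sum_i \sum_j (u i + v j) ^+ 2 =
  n%:R * (\sum_i u i ^+ 2) + m%:R * (\sum_j v j ^+ 2).
Proof.
move=> u0.
have E i : \sum_j (u i + v j) ^+ 2 =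
    u i ^+ 2 * n%:R + \sum_j v j ^+ 2 + u i * (2 * \sum_j v j).
  rewrite (eq_bigr (fun j => u i ^+ 2 + v j ^+ 2 + u i * (2 * v j))); last first.
    by move=> j _; ring.
  by rewrite !big_split/= sumr_const card_ord mulr_natr -!mulr_sumr.
under eq_bigr do rewrite E.
rewrite !big_split/= sumr_const card_ord -!mulr_suml u0 mul0r addr0 mulrC.
by rewrite -[_ *+ m]mulr_natl.
Qed.

(** The matrix [u_i + v_j] is a sum of two rank-one matrices. Once [u] is centred they are
    orthogonal, so each has Frobenius norm at most that of the sum and costs one factor [e]. *)
Lemma bilin_le_rank2 (R : realType) (m n : nat) (B : 'M[R]_(m, n)) (e : R)
    (u : 'I_m -> R) (v : 'I_n -> R) :
  (0 < m)%N -> 0 <= e -> bilin_le B e ->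
  \sum_i \sum_j (u i + v j) * B i j <=
  2 * e * euclid (fun ij : 'I_m * 'I_n => u ij.1 + v ij.2).
Proof.
(* Moving the mean of [u] over to [v] leaves every [u_i + v_j] unchanged. *)
move=> m0 e0 Be; pose mu := (\sum_i u i) / m%:R.
pose u' i := u i - mu; pose v' j := v j + mu.
have uv i j : u i + v j = u' i + v' j by rewrite /u' /v'; ring.
have u'0 : \sum_i u' i = 0.
  rewrite sumrB sumr_const card_ord -[_ *+ m]mulr_natr /mu divfK ?subrr//.
  by rewrite pnatr_eq0 -lt0n.
have := sum_rank2_sqr v' u'0; set S := euclid _.
have -> : \sum_i \sum_j (u' i + v' j) ^+ 2 = S ^+ 2.
  by rewrite euclid_sqr pair_big; apply: eq_bigr => ij _; rewrite -uv.
have su := euclid_sqr u'; have sv := euclid_sqr v'.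
rewrite -su -sv => HS.
have S0 : 0 <= S := euclid_ge0 _.
have c1 k : euclid (fun _ : 'I_k => 1 : R) = Num.sqrt k%:R.
  by rewrite /euclid sumr_const card_ord expr1n.
have h1 : euclid u' * Num.sqrt n%:R <= S.
  rewrite -(@ler_pXn2r _ 2)// ?nnegrE ?mulr_ge0 ?euclid_ge0 ?sqrtr_ge0//.
  by rewrite exprMn (@sqr_sqrtr _ n%:R)// mulrC HS lerDl mulr_ge0 ?sqr_ge0.
have h2 : Num.sqrt m%:R * euclid v' <= S.
  rewrite -(@ler_pXn2r _ 2)// ?nnegrE ?mulr_ge0 ?euclid_ge0 ?sqrtr_ge0//.
  by rewrite exprMn (@sqr_sqrtr _ m%:R)// HS lerDr mulr_ge0 ?sqr_ge0.
have := lerD (Be u' (fun=> 1)) (Be (fun=> 1) v'); rewrite !c1.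
have -> : \sum_i \sum_j u' i * 1 * B i j + \sum_i \sum_j 1 * v' j * B i j =
  \sum_i \sum_j (u i + v j) * B i j.
  rewrite -big_split/=; apply: eq_bigr => i _; rewrite -big_split/=.
  by apply: eq_bigr => j _; rewrite uv; ring.
move=> H; apply: (le_trans H); have := ler_wpM2l e0 h1; have := ler_wpM2l e0 h2; lra.
Qed.

(* The gradients of the convex scaling potential at the two scalings agree up
   to the perturbation, so its strong convexity controls the log-factors. *)
Lemma scaling_perturbation (R : realType) (m n : nat) (A B : 'M[R]_(m, n))
    (x x' : 'rV[R]_m) (y y' : 'rV[R]_n) (r : 'rV[R]_m) (c : 'rV[R]_n)
    (a b lo hi e : R) :
  (0 < m)%N -> 0 < a -> 0 < lo -> 0 <= e ->
  positive_mx x -> positive_mx y -> positive_mx x' -> positive_mx y' ->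
  scales x y A r c -> scales x' y' B r c ->
  (forall i j, a <= B i j <= b) ->
  (forall i j, lo <= x 0 i * y 0 j <= hi) ->
  (forall i j, lo <= x' 0 i * y' 0 j <= hi) ->
  bilin_le (B - A) e ->
  bilin_le (diag_mx x' *m B *m diag_mx y' - diag_mx x *m A *m diag_mx y)
    (e * hi * (1 + 2 * (b / a) * (hi / lo) ^+ 3)).
Proof.
move=> m0 a0 lo0 e0 x0 y0 x'0 y'0 [rA cA] [rB cB] Bab xy xy' BAe.
(* Without columns both sides are zero; otherwise some entry exists, which gives [lo <= hi] and
   [0 < b]. *)
have [n0|] := eqVneq n 0%N.
  move=> p q; rewrite big1 => [|i _]; last first.
    by rewrite big1// => j _; have := ltn_ord j; rewrite [X in (_ < X)%N]n0.
  have -> : euclid q = 0; last by rewrite !mulr0.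
  rewrite /euclid big1 ?sqrtr0// => j _.
  by have := ltn_ord j; rewrite [X in (_ < X)%N]n0.
rewrite -lt0n => n0.
pose i0 := Ordinal m0; pose j0 := Ordinal n0.
have lohi : lo <= hi by have /andP[] := xy i0 j0; apply: le_trans.
have hi0 : 0 < hi by apply: lt_le_trans lohi.
have b0 : 0 < b by have /andP[/(lt_le_trans a0)] := Bab i0 j0; apply: lt_le_trans.
pose K := hi / lo; have K1 : 1 <= K by rewrite ler_pdivlMr// mul1r.
have Klo : K * lo = hi by rewrite divfK// gt_eqF.
have K0 : 0 < K by apply: lt_le_trans K1.
have hiW := ltW hi0; have KW := ltW K0; have bW := ltW b0.
pose u i := ln (x' 0 i / x 0 i); pose v j := ln (y' 0 j / y 0 j).
pose t i j := (x' 0 i * y' 0 j) / (x 0 i * y 0 j).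
have xy0 i j : 0 < x 0 i * y 0 j by apply: mulr_gt0; [exact: x0|exact: y0].
have t0 i j : 0 < t i j.
  by apply: divr_gt0 => //; apply: mulr_gt0; [exact: x'0|exact: y'0].
have txy i j : t i j * (x 0 i * y 0 j) = x' 0 i * y' 0 j by rewrite divfK// gt_eqF.
have lnt i j : ln (t i j) = u i + v j.
  rewrite /u /v -lnM ?posrE ?divr_gt0 ?x0 ?y0 ?x'0 ?y'0//; congr ln.
  by rewrite /t; field; rewrite !gt_eqF ?x0 ?y0.
have cmp i j : (u i + v j) ^+ 2 <= K * ((t i j - 1) * (u i + v j)) /\
               `|t i j - 1| <= K * `|u i + v j|.
  rewrite -lnt; have /andP[h1 h2] := xy i j; have /andP[h3 h4] := xy' i j.
  apply: ln_compare_sub1 => //.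
    by rewrite /t mulrA ler_pdivlMr// mul1r (le_trans h2)// -Klo ler_wpM2l.
  by rewrite /t ler_pdivrMr// (le_trans h4)// -Klo ler_wpM2l.
(* The difference splits into [G], the perturbation seen through the old scaling, and [D], the
   effect on [B] of changing the scaling. *)
pose G := diag_mx x *m (B - A) *m diag_mx y.
pose D := \matrix_(i, j) (x 0 i * y 0 j * B i j * (t i j - 1)).
have DG : diag_mx x' *m B *m diag_mx y' - diag_mx x *m A *m diag_mx y = D + G.
  apply/matrixP => i j; rewrite !(diag_scaling_entry, mxE) -txy.
  by ring.
have Ge : bilin_le G (e * hi).
  apply: bilin_le_diag => //.
  by move=> i j; rewrite gtr0_norm//; have /andP[] := xy i j.
have row0 i : \sum_j (D + G) i j = 0.
  rewrite -DG (eq_bigr (fun j => x' 0 i * B i j * y' 0 j - x 0 i * A i j * y 0 j)).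
    by rewrite sumrB rA rB subrr.
  by move=> j _; rewrite !(diag_scaling_entry, mxE); ring.
have col0 j : \sum_i (D + G) i j = 0.
  rewrite -DG (eq_bigr (fun i => x' 0 i * B i j * y' 0 j - x 0 i * A i j * y 0 j)).
    by rewrite sumrB cA cB subrr.
  by move=> i _; rewrite !(diag_scaling_entry, mxE); ring.
pose Z := euclid (fun ij : 'I_m * 'I_n => u ij.1 + v ij.2).
have Z0 : 0 <= Z := euclid_ge0 _.
(* All row and column sums of [D + G] vanish, so its pairing with any matrix [u_i + v_j] is zero.
   Hence [D] may be exchanged for [- G], to which the rank-two bound applies. *)
have DZ : \sum_i \sum_j (u i + v j) * D i j <= 2 * (e * hi) * Z.
  have : \sum_i \sum_j (u i + v j) * (D + G) i j = 0.
    under eq_bigr do under eq_bigr do rewrite mulrDl.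
    under eq_bigr do rewrite big_split/= -mulr_sumr row0 mulr0 add0r.
    rewrite exchange_big/= big1// => j _.
    by rewrite -mulr_sumr col0 mulr0.
  under eq_bigr do under eq_bigr do rewrite mxE mulrDr.
  under eq_bigr do rewrite big_split/=.
  rewrite big_split/= => /eqP; rewrite addr_eq0 => /eqP ->.
  have := bilin_le_rank2 u v m0 (mulr_ge0 e0 (ltW hi0)) (bilin_le_opp Ge).
  apply: le_trans; rewrite -sumrN; apply: ler_sum => i _; rewrite -sumrN.
  by apply: ler_sum => j _; rewrite [in leRHS]mxE mulrN.
(* Strong convexity, entry by entry: [(t - 1) * ln t] dominates [ln t ^+ 2 / K], with weights at
   least [a * lo]. *)
have ZD : a * lo * Z ^+ 2 <= K * \sum_i \sum_j (u i + v j) * D i j.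
  rewrite euclid_sqr -(pair_bigA _ (fun i j => (u i + v j) ^+ 2))/= !mulr_sumr.
  apply: ler_sum => i _; rewrite !mulr_sumr; apply: ler_sum => j _.
  have [+ _] := cmp i j; rewrite [D i j]mxE => h.
  have /andP[h1 _] := xy i j; have /andP[h2 _] := Bab i j.
  have ab : a * lo <= x 0 i * y 0 j * B i j.
    by rewrite mulrC ler_pM// ltW.
  apply: (@le_trans _ _ (x 0 i * y 0 j * B i j * (u i + v j) ^+ 2)).
    by rewrite ler_wpM2r// sqr_ge0.
  apply: le_trans (ler_wpM2l _ h) _; first by rewrite (le_trans _ ab)// mulr_ge0// ltW.
  by rewrite le_eqVlt; apply/orP; left; apply/eqP; ring.
have alo0 : 0 < a * lo by apply: mulr_gt0.
have Zb : a * lo * Z <= 2 * K * (e * hi).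
  have h : a * lo * Z ^+ 2 <= 2 * K * (e * hi) * Z.
    by apply: (le_trans ZD); have := ler_wpM2l (ltW K0) DZ; lra.
  have [Zz|Zn] := eqVneq Z 0.
    by rewrite Zz mulr0 mulr_ge0// mulr_ge0.
  have Zp : 0 < Z by rewrite lt_def Zn.
  by rewrite -(ler_pM2r Zp) -[_ * Z * Z]mulrA -expr2.
have bhk : 0 <= b * hi * K by apply: mulr_ge0 => //; exact: mulr_ge0.
(* Here [|t - 1| <= K * |ln t|] turns the bound on the log-factors into a Frobenius bound on [D]. *)
have De : bilin_le D (b * hi * K * Z).
  have Df := bilin_le_frobenius D.
  move=> p q; apply: (le_trans (Df p q)); rewrite ler_wpM2r ?mulr_ge0 ?euclid_ge0//.
  rewrite /Z (_ : euclid (fun ij : 'I_m * 'I_n => u ij.1 + v ij.2) =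
    euclid (fun ij : 'I_m * 'I_n => `|u ij.1 + v ij.2|)); last first.
    by congr Num.sqrt; apply: eq_bigr => ij _; rewrite real_normK ?num_real.
  rewrite -euclidZ//; apply: euclid_le => -[i j] /=.
  rewrite mxE normrM -[b * hi * K * _]mulrA.
  have [_ h] := cmp i j; rewrite (ger0_norm (_ : 0 <= x 0 i * y 0 j * B i j)).
    have /andP[h1 h2] := xy i j; have /andP[h3 h4] := Bab i j.
    rewrite ler_pM ?normr_ge0//.
      by rewrite mulr_ge0 ?(ltW (xy0 i j))// (le_trans (ltW a0)).
    by rewrite [b * hi]mulrC ler_pM ?(ltW (xy0 i j))// (le_trans (ltW a0)).
  have /andP[h3 _] := Bab i j.
  by rewrite mulr_ge0 ?(ltW (xy0 i j))// (le_trans (ltW a0)).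
rewrite DG; move=> p q; apply: (le_trans (bilin_leD De Ge p q)).
rewrite ler_wpM2r ?mulr_ge0 ?euclid_ge0//.
have Zb' : Z <= 2 * K * (e * hi) / (a * lo) by rewrite ler_pdivlMr// mulrC.
have := ler_wpM2l bhk Zb'.
have -> : b * hi * K * (2 * K * (e * hi) / (a * lo)) =
   e * hi * (2 * (b / a) * K ^+ 3).
  by rewrite /K; field; rewrite !gt_eqF.
rewrite -/K; lra.
Qed.

(** * Quantitative bounds and continuity *)

Lemma scales_mass (R : realType) (m n : nat) (x : 'rV[R]_m) (y : 'rV[R]_n)
    (B : 'M[R]_(m, n)) (r : 'rV[R]_m) (c : 'rV[R]_n) :
  scales x y B r c -> \sum_j c 0 j = \sum_i r 0 i.
Proof.
case=> hr hc; under eq_bigr do rewrite -hc.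
by rewrite exchange_big/=; apply: eq_bigr => i _; rewrite hr.
Qed.

Lemma weighted_sum_between (R : realType) (I : finType) (f w : I -> R) (z a b : R) :
  0 <= z -> (forall i, 0 <= w i) -> (forall i, a <= f i <= b) ->
  a * (z * \sum_i w i) <= \sum_i z * f i * w i <= b * (z * \sum_i w i).
Proof.
move=> z0 w0 fab; rewrite !mulr_sumr; apply/andP; split; apply: ler_sum => i _;
  have /andP[h1 h2] := fab i;
  rewrite (_ : z * f i * w i = f i * (z * w i)) ?ler_wpM2r ?mulr_ge0//; ring.
Qed.

(** With [X] and [Y] the sums of [x] and [y], the entry bounds compare [r_i] with [x_i Y], [c_j]
    with [y_j X] and the total mass with [X Y]. Multiplying the first two and eliminating [X Y]
    leaves [x_i y_j]. *)
Lemma scales_product_bounds (R : realType) (m n : nat) (x : 'rV[R]_m)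
    (y : 'rV[R]_n) (B : 'M[R]_(m, n)) (r : 'rV[R]_m) (c : 'rV[R]_n) (a b : R) :
  0 < a -> (forall i j, a <= B i j <= b) ->
  positive_mx x -> positive_mx y -> scales x y B r c ->
  forall i j,
    a * (r 0 i * c 0 j) <= b ^+ 2 * (\sum_k r 0 k) * (x 0 i * y 0 j) /\
    a ^+ 2 * (\sum_k r 0 k) * (x 0 i * y 0 j) <= b * (r 0 i * c 0 j).
Proof.
move=> a0 Bab x0 y0 [hr hc] i j; set s := \sum_k r 0 k.
pose X := \sum_i x 0 i; pose Y := \sum_j y 0 j.
have b0 : 0 < b by have /andP[/(lt_le_trans a0)] := Bab i j; apply: lt_le_trans.
have X0 : 0 <= X by apply: sumr_ge0 => k _; rewrite ltW// x0.
have Y0 : 0 <= Y by apply: sumr_ge0 => k _; rewrite ltW// y0.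
have rb k : a * (x 0 k * Y) <= r 0 k <= b * (x 0 k * Y).
  by rewrite -hr; apply: weighted_sum_between => // [|l]; rewrite ltW// ?x0 ?y0.
have cb l : a * (y 0 l * X) <= c 0 l <= b * (y 0 l * X).
  rewrite -hc; rewrite (eq_bigr (fun k => y 0 l * B k l * x 0 k)) => [|k _]; last by ring.
  by apply: weighted_sum_between => // [|k]; rewrite ltW// ?x0 ?y0.
have sb : a * (X * Y) <= s <= b * (X * Y).
  rewrite mulr_suml !mulr_sumr; apply/andP; split; apply: ler_sum => k _;
    by have /andP[h1 h2] := rb k.
have /andP[r1 r2] := rb i; have /andP[c1 c2] := cb j; have /andP[s1 s2] := sb.
have xi : 0 < x 0 i := x0 _ _; have yj : 0 < y 0 j := y0 _ _.
have xY : 0 <= x 0 i * Y by rewrite mulr_ge0// ltW.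
have yX : 0 <= y 0 j * X by rewrite mulr_ge0// ltW.
have ri : 0 <= r 0 i by rewrite (le_trans _ r1)// mulr_ge0// ltW.
have cj : 0 <= c 0 j by rewrite (le_trans _ c1)// mulr_ge0// ltW.
split.
  have h : r 0 i * c 0 j <= b * (x 0 i * Y) * (b * (y 0 j * X)) by rewrite ler_pM.
  have := ler_wpM2l (ltW a0) h.
  have bxy : 0 <= b ^+ 2 * (x 0 i * y 0 j) by rewrite !mulr_ge0 ?sqr_ge0// ltW.
  have := ler_wpM2l bxy s1; lra.
have h : a * (x 0 i * Y) * (a * (y 0 j * X)) <= r 0 i * c 0 j.
  by rewrite ler_pM// mulr_ge0// ltW.
have := ler_wpM2l (ltW b0) h.
have axy : 0 <= a ^+ 2 * (x 0 i * y 0 j) by rewrite !mulr_ge0// ltW.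
have := ler_wpM2l axy s2; lra.
Qed.

Lemma spread_sum_bounds (R : realType) (n : nat) (v : 'rV[R]_n) (C : R) :
  (forall i k, v 0 i <= C * v 0 k) ->
  forall i, n%:R * v 0 i <= C * (\sum_k v 0 k) /\ \sum_k v 0 k <= C * (n%:R * v 0 i).
Proof.
move=> vC i; split.
  rewrite mulr_natl -[n in _ *+ n]card_ord -sumr_const mulr_sumr.
  by apply: ler_sum => k _.
rewrite mulrCA mulr_natl -[n in _ *+ n]card_ord -sumr_const.
by apply: ler_sum => k _.
Qed.

(* [lo] and [hi] are the bounds of scaling_factor_bounds for x_i y_j, relative to
   the average |r|_1 / (m n). *)
Definition scaling_const (R : realType) (a b C : R) : R :=
  let hi := b * C ^+ 2 / a ^+ 2 in let lo := a / (b ^+ 2 * C ^+ 2) in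
  hi * (1 + 2 * (b / a) * (hi / lo) ^+ 3).

Lemma scaling_const_ge0 (R : realType) (a b C : R) :
  0 <= a -> 0 <= b -> 0 <= scaling_const a b C.
Proof.
move=> a0 b0; rewrite /scaling_const.
have hi0 : 0 <= b * C ^+ 2 / a ^+ 2 by rewrite divr_ge0 ?sqr_ge0// mulr_ge0 ?sqr_ge0.
have lo0 : 0 <= a / (b ^+ 2 * C ^+ 2) by rewrite divr_ge0// mulr_ge0 ?sqr_ge0.
apply: mulr_ge0 => //; apply: addr_ge0 => //; apply: mulr_ge0.
  by apply: mulr_ge0 => //; apply: divr_ge0.
by apply: exprn_ge0; apply: divr_ge0.
Qed.

(** Each [r_i] and [c_j] is within a factor [C] of its average, so [r_i c_j] is comparable to the
    squared total mass over [m n]; here [tau] is the average entry of the scaled matrix. *)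
Lemma scaling_factor_bounds (R : realType) (m n : nat) (x : 'rV[R]_m)
    (y : 'rV[R]_n) (B : 'M[R]_(m, n)) (r : 'rV[R]_m) (c : 'rV[R]_n) (a b C : R) :
  0 < a -> 0 < C -> (forall i j, a <= B i j <= b) ->
  (forall i k, r 0 i <= C * r 0 k) -> (forall j k, c 0 j <= C * c 0 k) ->
  positive_mx x -> positive_mx y -> scales x y B r c ->
  let tau := (\sum_k r 0 k) / (m%:R * n%:R) in
  forall i j, a / (b ^+ 2 * C ^+ 2) * tau <= x 0 i * y 0 j
              <= b * C ^+ 2 / a ^+ 2 * tau.
Proof.
move=> a0 C0 Bab rC cC x0 y0 sc tau i j.
have [h1 h2] := scales_product_bounds a0 Bab x0 y0 sc i j.
have [r1 r2] := spread_sum_bounds rC i; have [c1 c2] := spread_sum_bounds cC j.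
rewrite (scales_mass sc) in c1 c2; set s := \sum_k r 0 k in h1 h2 r1 r2 c1 c2 tau *.
have b0 : 0 < b by have /andP[/(lt_le_trans a0)] := Bab i j; apply: lt_le_trans.
have m0 : 0 < m%:R :> R by rewrite ltr0n; apply: leq_ltn_trans (ltn_ord i).
have n0 : 0 < n%:R :> R by rewrite ltr0n; apply: leq_ltn_trans (ltn_ord j).
have aW := ltW a0; have bW := ltW b0; have CW := ltW C0.
have mW := ltW m0; have nW := ltW n0.
have xy0 : 0 < x 0 i * y 0 j by apply: mulr_gt0; [exact: x0|exact: y0].
have rp k : 0 < r 0 k.
  case: sc => <- _; rewrite (bigD1 j)//= ltr_pwDl ?mulr_gt0 ?x0 ?y0//.
    by have /andP[/(lt_le_trans a0)] := Bab k j.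
  apply: sumr_ge0 => l _; rewrite !mulr_ge0 ?(ltW (x0 _ _)) ?(ltW (y0 _ _))//.
  by have /andP[/(le_trans aW)] := Bab k l.
have s0 : 0 < s by rewrite /s (bigD1 i)//= ltr_pwDl// sumr_ge0// => k _; exact: ltW.
have cp : 0 <= c 0 j.
  by rewrite -(pmulr_rge0 _ n0) -(pmulr_rge0 _ C0) (le_trans _ c2)// ltW.
have rpW := ltW (rp i); have sW := ltW s0.
apply/andP; split.
  rewrite /tau mulf_div ler_pdivrMr ?mulr_gt0 ?exprn_gt0//.
  rewrite -(ler_pM2l s0).
  have h3 : s * s <= C * (m%:R * r 0 i) * (C * (n%:R * c 0 j)) by rewrite ler_pM.
  have h4 := ler_wpM2l aW h3.
  have h5 : 0 <= C ^+ 2 * m%:R * n%:R by rewrite !mulr_ge0 ?sqr_ge0.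
  have h6 := ler_wpM2l h5 h1; lra.
rewrite /tau mulf_div ler_pdivlMr ?mulr_gt0 ?exprn_gt0//.
rewrite -(ler_pM2l s0).
have h3 : m%:R * r 0 i * (n%:R * c 0 j) <= C * s * (C * s) by rewrite ler_pM// mulr_ge0.
have h4 := ler_wpM2l bW h3.
have h5 : 0 <= m%:R * n%:R :> R by rewrite !mulr_ge0.
have h6 := ler_wpM2l h5 h2; lra.
Qed.

(** The bounds on the scaling factors are both proportional to [tau], which cancels in [hi / lo];
    the estimate is therefore linear in [tau], with a constant independent of the dimensions. *)
Lemma scaling_stability (R : realType) (m n : nat) (A B P Q : 'M[R]_(m, n))
    (r : 'rV[R]_m) (c : 'rV[R]_n) (a b C e : R) :
  (0 < m)%N -> (0 < n)%N -> 0 < a -> 0 < b -> 0 < C -> 0 <= e ->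
  (forall i j, a <= A i j <= b) -> (forall i j, a <= B i j <= b) ->
  (forall i k, r 0 i <= C * r 0 k) -> (forall j k, c 0 j <= C * c 0 k) ->
  positive_mx r ->
  is_scaling_of A r c P -> is_scaling_of B r c Q -> bilin_le (B - A) e ->
  opnorm2 (Q - P) <=
  e * ((\sum_k r 0 k) / (m%:R * n%:R)) * scaling_const a b C.
Proof.
move=> m0 n0 a0 b0 C0 e0 Aab Bab rC cC r0 [x [y [x0 y0 sA ->]]].
move=> [x' [y' [x'0 y'0 sB ->]]] BAe; set tau := (\sum_k r 0 k) / _.
have tau0 : 0 < tau.
  rewrite divr_gt0 ?mulr_gt0 ?ltr0n// (bigD1 (Ordinal m0))//=.
  by rewrite ltr_pwDl// sumr_ge0// => k _; apply: ltW.
pose hi := b * C ^+ 2 / a ^+ 2; pose lo := a / (b ^+ 2 * C ^+ 2).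
have hi0 : 0 < hi by rewrite divr_gt0 ?mulr_gt0 ?exprn_gt0.
have lo0 : 0 < lo by rewrite divr_gt0 ?mulr_gt0 ?exprn_gt0.
have lot : 0 < lo * tau by rewrite mulr_gt0.
have := scaling_perturbation m0 a0 lot e0 x0 y0 x'0 y'0 sA sB Bab
  (scaling_factor_bounds a0 C0 Aab rC cC x0 y0 sA)
  (scaling_factor_bounds a0 C0 Bab rC cC x'0 y'0 sB) BAe.
rewrite -/tau -/hi (_ : hi * tau / (lo * tau) = hi / lo); last first.
  by field; rewrite !gt_eqF.
rewrite (_ : e * (hi * tau) * (1 + 2 * (b / a) * (hi / lo) ^+ 3) =
  e * tau * scaling_const a b C); last by rewrite /scaling_const -/hi -/lo; ring.
apply: opnorm2_le; apply: mulr_ge0; first by rewrite mulr_ge0// ltW.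
by apply: scaling_const_ge0; exact: ltW.
Qed.

(** Testing the form with all-ones vectors gives the sum of all entries. *)
Lemma opnorm2_scaling_ge (R : realType) (m n : nat) (A P : 'M[R]_(m, n))
    (r : 'rV[R]_m) (c : 'rV[R]_n) :
  is_scaling_of A r c P ->
  \sum_k r 0 k <= opnorm2 P * Num.sqrt (m%:R * n%:R).
Proof.
case=> x [y [_ _ [hr _] ->]]; set P' := _ *m _.
have := opnorm2_bilin_le P' (fun=> 1) (fun=> 1).
rewrite /euclid !sumr_const !card_ord expr1n -sqrtrM//; apply: le_trans.
apply: ler_sum => i _; rewrite -hr; apply: ler_sum => j _.
by rewrite diag_scaling_entry !mul1r mulrAC.
Qed.

(** The total mass occurs in the upper bound for [Q - P] and in the lower bound for [P], and cancels
    in the quotient. *)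
Lemma scaling_relative_stability (R : realType) (m n : nat)
    (A B P Q : 'M[R]_(m, n)) (r : 'rV[R]_m) (c : 'rV[R]_n) (a b C e : R) :
  (0 < m)%N -> (0 < n)%N -> 0 < a -> 0 < b -> 0 < C -> 0 <= e ->
  (forall i j, a <= A i j <= b) -> (forall i j, a <= B i j <= b) ->
  (forall i k, r 0 i <= C * r 0 k) -> (forall j k, c 0 j <= C * c 0 k) ->
  positive_mx r ->
  is_scaling_of A r c P -> is_scaling_of B r c Q -> bilin_le (B - A) e ->
  opnorm2 (Q - P) / opnorm2 P <=
  scaling_const a b C * (e / Num.sqrt (m%:R * n%:R)).
Proof.
move=> m0 n0 a0 b0 C0 e0 Aab Bab rC cC r0 AP BQ BAe.
have := scaling_stability m0 n0 a0 b0 C0 e0 Aab Bab rC cC r0 AP BQ BAe.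
have := opnorm2_scaling_ge AP; set s := \sum_k r 0 k; set K := scaling_const a b C.
have K0 : 0 <= K by apply: scaling_const_ge0; exact: ltW.
have s0 : 0 < s.
  by rewrite /s (bigD1 (Ordinal m0))//= ltr_pwDl// sumr_ge0// => k _; apply: ltW.
have mn0 : 0 < m%:R * n%:R :> R by rewrite mulr_gt0 ?ltr0n.
set q := Num.sqrt _; have q0 : 0 < q by rewrite sqrtr_gt0.
have qq : m%:R * n%:R = q ^+ 2 by rewrite sqr_sqrtr// ltW.
rewrite qq => hP hQ.
have P0 : 0 < opnorm2 P by rewrite -(pmulr_lgt0 _ q0) (lt_le_trans s0).
rewrite ler_pdivrMr//; apply: (le_trans hQ).
have -> : e * (s / q ^+ 2) * K = K * (e / q) * (s / q) by field; rewrite gt_eqF.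
rewrite ler_wpM2l; [by []| |by rewrite ler_pdivrMr].
by apply: mulr_ge0 => //; apply: divr_ge0 => //; exact: ltW.
Qed.

(** * Continuity of the scaled matrix and measurability *)

Lemma positive_lower_bound (R : realType) (I : finType) (f : I -> R) :
  (forall i, 0 < f i) -> exists2 a, 0 < a & forall i, a <= f i.
Proof.
move=> f0; have S0 : 0 <= \sum_i (f i)^-1 by apply: sumr_ge0 => i _; rewrite invr_ge0 ltW.
(* The summand 1 keeps the witness positive when the index type is empty. *)
exists (1 + \sum_i (f i)^-1)^-1; first by rewrite invr_gt0 ltr_pwDl.
move=> i; rewrite -[leRHS]invrK lef_pV2 ?posrE ?invr_gt0 ?ltr_pwDl//.
rewrite (bigD1 i)//= addrCA lerDl addr_ge0//.
by apply: sumr_ge0 => j _; rewrite invr_ge0 ltW.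
Qed.

Lemma positive_upper_bound (R : realType) (I : finType) (f : I -> R) :
  (forall i, 0 < f i) -> exists2 b, 0 < b & forall i, f i <= b.
Proof.
move=> f0; have S0 i : 0 <= f i := ltW (f0 i).
exists (1 + \sum_i f i); first by rewrite ltr_pwDl// sumr_ge0.
by move=> i; rewrite (bigD1 i)//= addrCA lerDl addr_ge0// sumr_ge0.
Qed.

Lemma positive_spread (R : realType) (n : nat) (v : 'rV[R]_n) :
  positive_mx v -> exists2 C, 0 < C & forall i k, v 0 i <= C * v 0 k.
Proof.
move=> v0; have [a a0 av] := positive_lower_bound (v0 0).
have [b b0 bv] := positive_upper_bound (v0 0).
exists (b / a); first exact: divr_gt0.
move=> i k; rewrite mulrAC ler_pdivlMr//.
by apply: ler_pM; rewrite // ltW.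
Qed.

Lemma scaling_continuous (R : realType) (m n : nat) (A P : 'M[R]_(m, n))
    (r : 'rV[R]_m) (c : 'rV[R]_n) (eps : R) :
  (0 < m)%N -> (0 < n)%N -> positive_mx A -> positive_mx r -> positive_mx c ->
  is_scaling_of A r c P -> 0 < eps ->
  exists2 delta, 0 < delta & forall B Q, is_scaling_of B r c Q ->
    (forall i j, `|B i j - A i j| < delta) -> opnorm2 (Q - P) <= eps.
Proof.
move=> m0 n0 A0 r0 c0 AP eps0.
have [a a0 aA] := @positive_lower_bound R _ (fun ij : 'I_m * 'I_n => A ij.1 ij.2)
  (fun ij => A0 ij.1 ij.2).
have [b b0 bA] := @positive_upper_bound R _ (fun ij : 'I_m * 'I_n => A ij.1 ij.2)
  (fun ij => A0 ij.1 ij.2).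
have [Cr Cr0 rC] := positive_spread r0; have [Cc Cc0 cC] := positive_spread c0.
pose C := Cr + Cc; have C0 : 0 < C by rewrite addr_gt0.
set tau := (\sum_k r 0 k) / (m%:R * n%:R).
have tau0 : 0 <= tau.
  by rewrite divr_ge0// sumr_ge0// => k _; apply: ltW; exact: r0.
pose K := Num.sqrt (m * n)%:R * tau * scaling_const (a / 2) (b + a) C.
have a20 : 0 < a / 2 by rewrite divr_gt0.
have ba0 : 0 < b + a by rewrite addr_gt0.
have K0 : 0 <= K.
  apply: mulr_ge0; first by rewrite mulr_ge0// sqrtr_ge0.
  by apply: scaling_const_ge0; exact: ltW.
have K10 : 0 < 1 + K by rewrite ltr_pwDl.
(* The first bound keeps the entries of [B] in [[a/2, b + a]]; the second makes the stability
   estimate [delta * K] at most [eps], with [1 + K] because [K] may be zero. *)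
exists (Num.min (a / 2) (eps / (1 + K))).
  by rewrite lt_min a20 divr_gt0.
move=> B Q BQ BA; set d := Num.min _ _ in BA.
have dle : d <= a / 2 by rewrite ge_min lexx.
have deps : d <= eps / (1 + K) by rewrite ge_min lexx orbT.
have d0 : 0 < d by rewrite lt_min a20 divr_gt0.
have Aab i j : a / 2 <= A i j <= b + a.
  by have := aA (i, j); have := bA (i, j) => /= h1 h2; apply/andP; split; lra.
have Bab i j : a / 2 <= B i j <= b + a.
  have := BA i j; rewrite ltr_norml => /andP[h3 h4].
  by have := aA (i, j); have := bA (i, j) => /= h1 h2; apply/andP; split; lra.
have rC' i k : r 0 i <= C * r 0 k.
  by apply: (le_trans (rC i k)); rewrite ler_wpM2r ?lerDl// ltW// r0.
have cC' i k : c 0 i <= C * c 0 k.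
  by apply: (le_trans (cC i k)); rewrite ler_wpM2r ?lerDr// ltW// c0.
have BAd : bilin_le (B - A) (d * Num.sqrt (m * n)%:R).
  by apply: bilin_le_entry => i j; rewrite !mxE; exact: ltW.
have e0 : 0 <= d * Num.sqrt (m * n)%:R by rewrite mulr_ge0 ?sqrtr_ge0// ltW.
have := scaling_stability m0 n0 a20 ba0 C0 e0 Aab Bab rC' cC' r0 AP BQ BAd.
rewrite -/tau => h; apply: (le_trans h).
rewrite (_ : d * _ * tau * _ = d * K); last by rewrite /K; ring.
move: deps; rewrite ler_pdivlMr//; nra.
Qed.

(* Boxes with rational centre and radius 1/k form a countable base. *)
Lemma measurable_sample_open (R : realType) (d : measure_display)
    (T : measurableType d) (P : probability T R) (m n : nat)
    (X : 'I_m -> 'I_n -> {RV P >-> R}) (S : set T) :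
  (forall w, S w -> exists2 delta, 0 < delta & forall w',
     (forall i j, `|X i j w' - X i j w| < delta) -> S w') ->
  measurable S.
Proof.
move=> Sopen.
pose box (q : {ffun 'I_m * 'I_n -> rat} * nat) : set T :=
  [set w | forall ij, `|X ij.1 ij.2 w - ratr (q.1 ij)| < q.2.+1%:R^-1].
have -> : S = \bigcup_(q in [set q | box q `<=` S]) box q.
  apply/seteqP; split => [w Sw|w [q /= qS]]; last exact: qS.
  have [dl dl0 Sdl] := Sopen w Sw.
  (* The radius is below [dl / 2] because [w] and [w'] are compared through the centre of the
     box. *)
  have [k [e [e0 ek edl]]] : exists (k : nat) (e : R),
      [/\ 0 < e, e = k.+1%:R^-1 & 2 * e < dl].
    exists (Num.truncn (2 / dl)), (Num.truncn (2 / dl)).+1%:R^-1.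
    split; rewrite ?invr_gt0// ltr_pdivrMr// mulrC -ltr_pdivrMr//.
    exact: truncnS_gt.
  have exq (ij : 'I_m * 'I_n) : exists q : rat,
      `|X ij.1 ij.2 w - ratr q| < e.
    have [|q /=] := @rat_in_itvoo R (X ij.1 ij.2 w - e) (X ij.1 ij.2 w + e).
      by lra.
    rewrite in_itv/= => /andP[h1 h2]; exists q.
    by rewrite ltr_norml; apply/andP; split; lra.
  have [q qP] := choice exq.
  exists ([ffun ij => q ij], k); last by move=> ij /=; rewrite ffunE -ek.
  move=> w' /= w'box; apply: Sdl => i j.
  have := w'box (i, j); have := qP (i, j); rewrite ffunE/= -ek.
  rewrite !ltr_norml => /andP[h1 h2] /andP[h3 h4].
  by apply/andP; split; lra.
rewrite bigcup_mkcond; apply: countable_bigcupT_measurable; first exact: countableP.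
move=> q; case: ifP => // _.
have -> : box q = \bigcap_(ij in [set: 'I_m * 'I_n]) (X ij.1 ij.2 @^-1`
    `]ratr (q.1 ij) - q.2.+1%:R^-1, ratr (q.1 ij) + q.2.+1%:R^-1[%classic).
  apply/seteqP; split=> w /= h ij => [_|]; have := h ij.
    by rewrite /= in_itv/= ltr_distl.
  by move=> /(_ Logic.I); rewrite /= in_itv/= ltr_distl.
apply: fin_bigcap_measurable => [|ij _]; first exact: finite_finset.
exact: measurable_funPTI.
Qed.

(** * Concentration on finite product spaces *)

(** The isolated linear term disappears when a centred variable is averaged. For [x >= 1/2] already
    [x <= 2 * x ^+ 2]; below that, [expR x <= (1 - x)^-1 <= 1 + x + 2 * x ^+ 2]. *)
Lemma expR_le_add_expR_sqr (R : realType) (x : R) : expR x <= x + expR (2 * x ^+ 2).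
Proof.
have e1 := expR_ge1Dx (2 * x ^+ 2).
have inv_bound (y : R) : 0 < 1 + y -> expR (- y) <= (1 + y)^-1.
  by move=> y0; rewrite expRN lef_pV2 ?posrE ?expR_gt0// expR_ge1Dx.
have [x12|x12] := leP (1 / 2) x.
  have : expR x <= expR (2 * x ^+ 2) by rewrite ler_expR; nra.
  lra.
have [x0|x0] := leP 0 x.
  have := inv_bound (- x); rewrite opprK => /(_ ltac:(lra)) h.
  have : (1 - x)^-1 <= 1 + x + 2 * x ^+ 2.
    by rewrite -[leLHS]mul1r ler_pdivrMr; nra.
  lra.
have := inv_bound (- x); rewrite opprK => /(_ ltac:(lra)) h.
have : (1 - x)^-1 <= 1 + x + 2 * x ^+ 2.
  by rewrite -[leLHS]mul1r ler_pdivrMr; nra.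
lra.
Qed.

Lemma centered_mgf_le (R : realType) (K : finType) (p y : K -> R) (s beta : R) :
  (forall k, 0 <= p k) -> \sum_k p k = 1 -> \sum_k p k * y k = 0 ->
  (forall k, `|y k| <= beta) ->
  \sum_k p k * expR (s * y k) <= expR (2 * (s * beta) ^+ 2).
Proof.
move=> p0 p1 py yb.
apply: (@le_trans _ _ (\sum_k (s * (p k * y k) + p k * expR (2 * (s * beta) ^+ 2)))).
  apply: ler_sum => k _; rewrite mulrCA -mulrDr ler_wpM2l//.
  apply: le_trans (expR_le_add_expR_sqr _) _; rewrite lerD2l ler_expR.
  rewrite ler_pM2l// !exprMn ler_wpM2l ?sqr_ge0// -real_normK ?num_real//.
  by rewrite lerXn2r ?nnegrE// (le_trans _ (yb k)).
by rewrite big_split/= -mulr_sumr py mulr0 add0r -mulr_suml p1 mul1r.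
Qed.

Lemma sum_ffun_prod (R : realType) (I K : finType) (F : I -> K -> R) :
  \sum_(v : {ffun I -> K}) \prod_i F i (v i) = \prod_i \sum_k F i k.
Proof. by rewrite bigA_distr_bigA. Qed.

Lemma hoeffding_product (R : realType) (I K : finType) (p y : I -> K -> R)
    (w : I -> R) (beta t : R) :
  (forall i k, 0 <= p i k) -> (forall i, \sum_k p i k = 1) ->
  (forall i, \sum_k p i k * y i k = 0) -> (forall i k, `|y i k| <= beta) ->
  0 < beta -> 0 <= t -> \sum_i w i ^+ 2 <= 1 ->
  \sum_(v : {ffun I -> K} | t < \sum_i w i * y i (v i)) \prod_i p i (v i)
  <= expR (- (t ^+ 2 / (8 * beta ^+ 2))).
Proof.
(* Chernoff's method; this [s] minimises the final exponent [- s t + 2 s^2 beta^2]. *)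
move=> p0 p1 py yb b0 t0 w1; pose s := t / (4 * beta ^+ 2).
have s0 : 0 <= s by rewrite divr_ge0// mulr_ge0// sqr_ge0.
apply: (@le_trans _ _ (expR (- (s * t)) *
   \sum_(v : {ffun I -> K}) \prod_i (p i (v i) * expR ((s * w i) * y i (v i))))).
  rewrite big_mkcond mulr_sumr; apply: ler_sum => v _.
  have pv : 0 <= \prod_i p i (v i) by apply: prodr_ge0.
  rewrite big_split/= -expR_sum mulrCA -expRD.
  case: ifPn => [tv|_]; last by rewrite mulr_ge0// expR_ge0.
  rewrite ler_peMr// -[leLHS]expR0 ler_expR.
  under eq_bigr do rewrite -mulrA.
  by rewrite -mulr_sumr addrC -mulrBr mulr_ge0// subr_ge0 ltW.
(* The sum of products over all outcomes is a product of sums: independence of the coordinates. *)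
rewrite (sum_ffun_prod (fun i k => p i k * expR (s * w i * y i k))).
apply: (@le_trans _ _ (expR (- (s * t)) * \prod_i expR (2 * (s * w i * beta) ^+ 2))).
  rewrite ler_wpM2l ?expR_ge0//; apply: ler_prod => i _.
  rewrite sumr_ge0 => [|k _]; last by rewrite mulr_ge0 ?expR_ge0.
  exact: centered_mgf_le.
rewrite -expR_sum -expRD ler_expR.
under eq_bigr do rewrite mulrAC exprMn mulrA.
rewrite -mulr_sumr.
apply: (@le_trans _ _ (- (s * t) + 2 * (s * beta) ^+ 2)).
  by rewrite lerD2l ler_piMr// mulr_ge0// sqr_ge0.
rewrite le_eqVlt; apply/orP; left; apply/eqP; rewrite /s; field.
by rewrite gt_eqF.
Qed.

Lemma union_bound_sum (R : realType) (V G : finType) (q : V -> R)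
    (bad : G -> pred V) (e : R) :
  (forall v, 0 <= q v) -> (forall g, \sum_(v | bad g v) q v <= e) ->
  \sum_(v | [exists g, bad g v]) q v <= #|G|%:R * e.
Proof.
move=> q0 be; rewrite mulr_natl -sumr_const.
apply: (@le_trans _ _ (\sum_g \sum_(v | bad g v) q v)); last exact: ler_sum.
rewrite big_mkcond; under [leRHS]eq_bigr do rewrite big_mkcond.
rewrite exchange_big/=; apply: ler_sum => v _.
have t0 g : 0 <= (if bad g v then q v else 0) by case: ifP.
case: ifPn => [/existsP[g bg]|_]; last by rewrite sumr_ge0.
by rewrite (bigD1 g)//= bg lerDl sumr_ge0.
Qed.

(** * Reduction to test vectors on a finite grid *)

Lemma bilin_le_unit (R : realType) (m n : nat) (B : 'M[R]_(m, n)) (e : R) :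
  (forall (p : 'I_m -> R) (q : 'I_n -> R), euclid p <= 1 -> euclid q <= 1 ->
    \sum_i \sum_j p i * q j * B i j <= e) -> bilin_le B e.
Proof.
move=> h p q.
have zero (I : finType) (f : I -> R) : euclid f = 0 -> forall i, f i = 0.
  move=> f0 i; apply/eqP; rewrite -sqrf_eq0.
  have : \sum_i f i ^+ 2 = 0 by rewrite -euclid_sqr f0 expr0n.
  by move/psumr_eq0P => /(_ (fun i _ => sqr_ge0 _)) ->.
have [p0|pn] := eqVneq (euclid p) 0.
  rewrite p0 mul0r mulr0 big1// => i _; rewrite big1// => j _.
  by rewrite (zero _ _ p0) !mul0r.
have [q0|qn] := eqVneq (euclid q) 0.
  rewrite q0 mulr0 mulr0 big1// => i _; rewrite big1// => j _.
  by rewrite (zero _ _ q0) mulr0 mul0r.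
have pp : 0 < euclid p by rewrite lt_def pn euclid_ge0.
have qp : 0 < euclid q by rewrite lt_def qn euclid_ge0.
have ip : 0 <= (euclid p)^-1 by rewrite invr_ge0 ltW.
have iq : 0 <= (euclid q)^-1 by rewrite invr_ge0 ltW.
have := h (fun i => (euclid p)^-1 * p i) (fun j => (euclid q)^-1 * q j).
rewrite !euclidZ// !mulVf// lexx => /(_ isT isT) hh.
rewrite -ler_pdivrMr ?mulr_gt0//; apply: le_trans hh.
rewrite mulr_suml; apply: ler_sum => i _; rewrite mulr_suml; apply: ler_sum => j _.
by rewrite le_eqVlt; apply/orP; left; apply/eqP; field; rewrite pn qn.
Qed.

(** Multiples of [1/H] in [[-1, 1]], with the boolean as sign. Zero has two codes, which merely
    enlarges the union bound. *)
Definition grid_val (R : realType) (H : nat) (k : 'I_H.+1 * bool) : R :=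
  (-1) ^+ k.2 * (k.1%:R / H%:R).

(** Rounding is towards zero, so that a rounded vector does not leave the unit ball. *)
Lemma grid_approx (R : realType) (H : nat) (x : R) : (0 < H)%N -> `|x| <= 1 ->
  exists k, `|x - grid_val R (H := H) k| <= H%:R^-1 /\ `|grid_val R k| <= `|x|.
Proof.
move=> H0 x1; have Hp : 0 < H%:R :> R by rewrite ltr0n.
pose k := Num.truncn (`|x| * H%:R).
have /andP[k1 k2] : k%:R <= `|x| * H%:R < k.+1%:R by rewrite truncn_itv// mulr_ge0// ltW.
have kH : (k < H.+1)%N.
  by rewrite ltnS -(ler_nat R) (le_trans k1)// ler_piMl// ltW.
exists (Ordinal kH, x < 0); rewrite /grid_val/=.
have e : `|k%:R / H%:R| = k%:R / H%:R :> R by rewrite ger0_norm// divr_ge0// ltW.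
rewrite normrM normrX normrN1 expr1n mul1r e ler_pdivrMr// k1; split=> //.
have d1 : k%:R / H%:R <= `|x| by rewrite ler_pdivrMr.
have d2 : `|x| <= k%:R / H%:R + H%:R^-1.
  by rewrite -[X in _ + X]mul1r -mulrDl ler_pdivlMr// natr1 ltW.
move: d1 d2; move: (k%:R / H%:R : R) (H%:R^-1 : R) => z h d1 d2.
have [x0|x0] := ltP x 0.
  rewrite expr1 mulN1r opprK; move: d1 d2; rewrite ltr0_norm// => d1 d2.
  by rewrite ler_norml; apply/andP; split; lra.
rewrite expr0 mul1r; move: d1 d2; rewrite ger0_norm// => d1 d2.
by rewrite ler_norml; apply/andP; split; lra.
Qed.

Definition grid (m H : nat) := {ffun 'I_m -> 'I_H.+1 * bool}.

Definition in_ball (R : realType) (m H : nat) (g : grid m H) : bool :=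
  \sum_i grid_val R (g i) ^+ 2 <= 1.

(** Rounding both vectors changes each product [p_i q_j] by at most [2/H]; the error is summed
    crudely over all [m n] entries, which a fine grid can afford. *)
Lemma bilin_le_net (R : realType) (m n H : nat) (B : 'M[R]_(m, n)) (beta t : R) :
  (0 < H)%N -> (forall i j, `|B i j| <= beta) ->
  (forall (g : grid m H) (h : grid n H), in_ball R g -> in_ball R h ->
     \sum_i \sum_j grid_val R (g i) * grid_val R (h j) * B i j <= t) ->
  bilin_le B (t + 2 * beta * ((m * n)%:R / H%:R)).
Proof.
move=> H0 Bb net; apply: bilin_le_unit => p q p1 q1.
have coord (I : finType) (f : I -> R) i : euclid f <= 1 -> `|f i| <= 1.
  move=> f1; rewrite -(@ler_pXn2r _ 2)// ?nnegrE// expr1n real_normK ?num_real//.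
  apply: (@le_trans _ _ (euclid f ^+ 2)).
    rewrite euclid_sqr (bigD1 i)//= lerDl.
    by apply: sumr_ge0 => j _; exact: sqr_ge0.
  by rewrite expr_le1// euclid_ge0.
have ball (k : nat) (f : 'I_k -> R) (g : grid k H) : euclid f <= 1 ->
    (forall i, `|grid_val R (g i)| <= `|f i|) -> in_ball R g.
  move=> f1 gf; apply: (@le_trans _ _ (euclid f ^+ 2)); last first.
    by rewrite expr_le1// euclid_ge0.
  rewrite euclid_sqr; apply: ler_sum => i _.
  by rewrite -real_normK ?num_real// -[leRHS]real_normK ?num_real// lerXn2r ?nnegrE.
have [g gP] := choice (fun i => grid_approx H0 (coord _ p i p1)).
have [h hP] := choice (fun j => grid_approx H0 (coord _ q j q1)).
have gb : in_ball R ([ffun i => g i] : grid m H).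
  by apply: (ball _ p) => // i; rewrite ffunE; case: (gP i).
have hb : in_ball R ([ffun i => h i] : grid n H).
  by apply: (ball _ q) => // i; rewrite ffunE; case: (hP i).
have := net _ _ gb hb.
under eq_bigr do under eq_bigr do rewrite !ffunE.
move=> net1; rewrite -lerBlDl.
apply: (@le_trans _ _ (\sum_i \sum_j p i * q j * B i j -
  \sum_i \sum_j grid_val R (g i) * grid_val R (h j) * B i j)).
  by rewrite lerD2l lerN2.
rewrite -sumrB (_ : _ * (_ / _) = \sum_(i < m) \sum_(j < n) (2 * H%:R^-1) * beta).
  apply: ler_sum => i _; rewrite -sumrB; apply: ler_sum => j _.
  rewrite -mulrBl; apply: le_trans (ler_norm _) _; rewrite normrM ler_pM//.
  have [g1 g2] := gP i; have [h1 h2] := hP j.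
  rewrite (_ : p i * q j - _ = p i * (q j - grid_val R (h j)) +
    (p i - grid_val R (g i)) * grid_val R (h j)); last by ring.
  apply: le_trans (ler_normD _ _) _.
  rewrite (normrM (p i)) (normrM (p i - _)) mulr_natl mulr2n lerD//.
    by rewrite -[leRHS]mul1r ler_pM// coord.
  have h3 : `|grid_val R (h j)| <= 1 by apply: (le_trans h2); exact: coord.
    by rewrite -[leRHS]mulr1 ler_pM.
rewrite !sumr_const !card_ord -[_ *+ n]mulr_natl -[_ *+ m]mulr_natl natrM; ring.
Qed.

(** For a fixed pair in the balls the weights [g_i h_j] have squares summing to at most 1, so
    Hoeffding's bound applies; the prefactor is the number of grid pairs. *)
Lemma net_tail (R : realType) (m n H : nat) (K : finType)
    (p y : 'I_m * 'I_n -> K -> R) (beta t : R) :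
  (forall ij k, 0 <= p ij k) -> (forall ij, \sum_k p ij k = 1) ->
  (forall ij, \sum_k p ij k * y ij k = 0) -> (forall ij k, `|y ij k| <= beta) ->
  0 < beta -> 0 <= t ->
  \sum_(v : {ffun 'I_m * 'I_n -> K} | [exists gh : grid m H * grid n H,
      [&& in_ball R gh.1, in_ball R gh.2 &
          t < \sum_ij grid_val R (gh.1 ij.1) * grid_val R (gh.2 ij.2) * y ij (v ij)]])
    \prod_ij p ij (v ij)
  <= (2 * H.+1)%:R ^+ (m + n) * expR (- (t ^+ 2 / (8 * beta ^+ 2))).
Proof.
move=> p0 p1 py yb b0 t0.
have card_net : #|{: grid m H * grid n H}| = ((2 * H.+1) ^ (m + n))%N.
  rewrite card_prod !card_ffun !card_ord card_prod card_ord card_bool.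
  by rewrite expnD [(_.+1 * 2)%N]mulnC.
rewrite -natrX -card_net; apply: union_bound_sum => [v|[g h]].
  by apply: prodr_ge0.
have [/andP[gb hb]|nb] := boolP (in_ball R g && in_ball R h); last first.
  rewrite big_pred0 ?expR_ge0// => v /=.
  by apply/negP => /and3P[gb hb _]; move: nb; rewrite gb hb.
under eq_bigl do rewrite /= gb hb/=.
apply: hoeffding_product => //.
rewrite (eq_bigr (fun ij => grid_val R (g ij.1) ^+ 2 * grid_val R (h ij.2) ^+ 2)).
  rewrite -(pair_bigA _ (fun i j => grid_val R (g i) ^+ 2 * grid_val R (h j) ^+ 2))/=.
  under eq_bigr do rewrite -mulr_sumr.
  by rewrite -mulr_suml mulr_ile1// sumr_sqr_ge0.
by move=> ij _; rewrite exprMn.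
Qed.

(** * Rounding independent random variables *)

Lemma prob_finite_event (R : realType) (d : measure_display)
    (T : measurableType d) (P : probability T R) (V : finType) (D : T -> V)
    (S : pred V) :
  (forall v, measurable [set w | D w = v]) ->
  measurable [set w | S (D w)] /\
  P [set w | S (D w)] = (\sum_(v | S v) P [set w | D w = v])%E.
Proof.
move=> mD.
have -> : [set w | S (D w)] = \bigcup_(v in [set` enum S]) [set w | D w = v].
  apply/seteqP; split => [w Sw|w [v /= + Dv]]; last by rewrite mem_enum Dv.
  by exists (D w) => //=; rewrite mem_enum.
split; first exact: fin_bigcup_measurable.
rewrite measure_fin_bigcup//; last by move=> v v' _ _ [w [/= <- <-]].
by rewrite -fsbig_seq ?enum_uniq// big_enum.
Qed.

(** Independence over the whole index set makes the probability of each digit pattern a product.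
    Events about digits thus become finite sums, to which the product-space bounds apply. *)
Lemma prob_digits (R : realType) (d : measure_display)
    (T : measurableType d) (P : probability T R) (I K : finType)
    (X : I -> {RV P >-> R}) (dig : R -> K) (S : pred {ffun I -> K}) :
  mutually_independent X -> (forall k, measurable [set x | dig x = k]) ->
  let D w := [ffun i => dig (X i w)] in
  measurable [set w | S (D w)] /\
  P [set w | S (D w)] =
  (\sum_(v | S v) \prod_i fine (P [set w | dig (X i w) = v i]))%:E.
Proof.
move=> indX mdig D.
have mX i k : measurable [set w | dig (X i w) = k].
  exact: (measurable_funPTI (X i) (mdig k)).
have Dv v : [set w | D w = v] =
    \bigcap_(i in [set` [set: I]%SET]) (X i @^-1` [set x | dig x = v i]).
  apply/seteqP; split => w /=.
    by move=> <- i _ /=; rewrite ffunE.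
  by move=> h; apply/ffunP => i; rewrite ffunE; apply: h; rewrite /= inE.
have mDv v : measurable [set w | D w = v].
  by rewrite Dv; apply: fin_bigcap_measurable => // i _; exact: mX.
have [mS ->] := prob_finite_event P S mDv; split => //.
rewrite -sumEFin; apply: eq_bigr => v _.
rewrite Dv indX// -prodEFin; apply: eq_big => [i|i _]; first by rewrite inE.
by rewrite fineK ?fin_num_measure//; exact: mX.
Qed.

(** The floor of [x L], capped so that the type of values stays finite even where the almost sure
    bound [x <= b] fails. *)
Definition digit (R : realType) (b : R) (L : nat) (x : R) :
    'I_(Num.truncn (b * L%:R)).+1 :=
  inord (minn (Num.truncn (x * L%:R)) (Num.truncn (b * L%:R))).

Lemma digit_val (R : realType) (b : R) (L : nat) (x : R) :
  digit b L x = minn (Num.truncn (x * L%:R)) (Num.truncn (b * L%:R)) :> nat.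
Proof. by rewrite inordK// ltnS geq_minr. Qed.

Lemma digit_approx (R : realType) (b : R) (L : nat) (x : R) :
  (0 < L)%N -> 0 <= x <= b ->
  (digit b L x)%:R / L%:R <= x <= (digit b L x)%:R / L%:R + L%:R^-1.
Proof.
move=> L0 /andP[x0 xb]; have Lp : 0 < L%:R :> R by rewrite ltr0n.
rewrite digit_val (minn_idPl _); last by rewrite le_truncn// ler_wpM2r// ltW.
have /andP[h1 h2] : (Num.truncn (x * L%:R))%:R <= x * L%:R
    < (Num.truncn (x * L%:R)).+1%:R by rewrite truncn_itv// mulr_ge0// ltW.
rewrite ler_pdivrMr// h1/= -[X in _ + X]mul1r -mulrDl ler_pdivlMr// natr1.
exact: ltW.
Qed.

Lemma digit_le (R : realType) (b : R) (L : nat) (k : 'I_(Num.truncn (b * L%:R)).+1) :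
  (0 < L)%N -> 0 <= b -> k%:R / L%:R <= b.
Proof.
move=> L0 b0; have Lp : 0 < L%:R :> R by rewrite ltr0n.
rewrite ler_pdivrMr// (@le_trans _ _ (Num.truncn (b * L%:R))%:R)//.
  by rewrite ler_nat -ltnS.
by rewrite truncn_le mulr_ge0// ltW.
Qed.

Lemma measurable_digit (R : realType) (b : R) (L : nat) k :
  (0 < L)%N -> measurable [set x : R | digit b L x = k].
Proof.
move=> L0; have Lp : 0 < L%:R :> R by rewrite ltr0n.
have mle (j : nat) : measurable [set x : R | (digit b L x <= j)%N].
  have [bj|jb] := leqP (Num.truncn (b * L%:R)) j.
    rewrite (_ : [set x | _] = setT)//; apply/seteqP; split => // x _ /=.
    by rewrite digit_val geq_min bj orbT.
  rewrite (_ : [set x | _] = `]-oo, (j.+1%:R / L%:R)[%classic)//.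
  apply/seteqP; split => x /=;
    rewrite in_itv/= digit_val geq_min [X in _ || X]leqNgt jb orbF.
    by rewrite truncn_le_nat ltr_pdivlMr.
  by rewrite truncn_le_nat ltr_pdivlMr.
(* A level set is a difference of two sublevel sets. The case [k = 0] is separate because [k.-1]
   would be 0 again. *)
rewrite (_ : [set x | _] = [set x | (digit b L x <= k)%N] `\`
   (if k == 0%N :> nat then set0 else [set x | (digit b L x <= k.-1)%N])).
  by apply: measurableD => //; case: ifP.
apply/seteqP; split => x /=.
  move=> xk; rewrite xk; split => //; case: eqP => [_ []|k0] /=.
  have kp : (0 < k)%N by rewrite lt0n; exact/eqP.
  by apply/negP; rewrite xk -ltnNge prednK.
case=> xk; case: eqP => [k0 _|k0 /negP].
  by apply/val_inj; move: xk; rewrite /= k0; case: (nat_of_ord _).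
rewrite -ltnNge prednK; last by rewrite lt0n; exact/eqP.
by move=> kx; apply/val_inj/eqP; rewrite /= eqn_leq xk.
Qed.

Lemma measurable_digit_event (R : realType) (d : measure_display)
    (T : measurableType d) (P : probability T R) (X : {RV P >-> R}) (b : R)
    (L : nat) k :
  (0 < L)%N -> measurable [set w | digit b L (X w) = k].
Proof. by move=> L0; exact: (measurable_funPTI X (measurable_digit k L0)). Qed.

Definition digit_pmf (R : realType) (d : measure_display)
    (T : measurableType d) (P : probability T R) (X : {RV P >-> R}) (b : R)
    (L : nat) (k : 'I_(Num.truncn (b * L%:R)).+1) : R :=
  fine (P [set w | digit b L (X w) = k]).

Definition digit_mean (R : realType) (d : measure_display)
    (T : measurableType d) (P : probability T R) (X : {RV P >-> R}) (b : R)
    (L : nat) : R :=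
  \sum_(k < (Num.truncn (b * L%:R)).+1) digit_pmf X k * (k%:R / L%:R).

Lemma digit_pmf_sum (R : realType) (d : measure_display)
    (T : measurableType d) (P : probability T R) (X : {RV P >-> R}) (b : R)
    (L : nat) :
  (0 < L)%N -> \sum_(k < (Num.truncn (b * L%:R)).+1) digit_pmf X k = 1.
Proof.
move=> L0.
have mD (k : 'I_(Num.truncn (b * L%:R)).+1) :=
  measurable_digit_event X k L0.
have [_] := prob_finite_event P predT mD.
rewrite (_ : [set w | _] = setT) ?probability_setT; last by apply/seteqP; split.
under eq_bigr do rewrite -(fineK (fin_num_measure P _ (mD _))).
by rewrite sumEFin => -[].
Qed.

Lemma digit_mean_approx (R : realType) (d : measure_display)
    (T : measurableType d) (P : probability T R) (X : {RV P >-> R}) (b : R)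
    (L : nat) :
  (0 < L)%N -> (forall w, 0 <= X w) -> {ae P, forall w, X w <= b} ->
  digit_mean X b L <= fine ('E_P[X])%E <= digit_mean X b L + L%:R^-1.
Proof.
move=> L0 X0 Xb; set mean := digit_mean X b L.
have mD (k : 'I_(Num.truncn (b * L%:R)).+1) :=
  measurable_digit_event X k L0.
have Lp : 0 < L%:R :> R by rewrite ltr0n.
pose phi w : R := (digit b L (X w))%:R / L%:R.
(* As a combination of indicators, the rounded variable is measurable and has expectation [mean]. *)
have phiE w : phi w = \sum_(k < (Num.truncn (b * L%:R)).+1)
    k%:R / L%:R * \1_[set w | digit b L (X w) = k] w.
  rewrite (bigD1 (digit b L (X w)))//= big1 ?addr0.
    by rewrite indicE mem_set// mulr1.
  by move=> k kn; rewrite indicE memNset ?mulr0//= => /eqP; rewrite eq_sym (negbTE kn).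
have mphi : measurable_fun [set: T] phi.
  rewrite (_ : phi = fun w => \sum_(k < (Num.truncn (b * L%:R)).+1)
    k%:R / L%:R * \1_[set w | digit b L (X w) = k] w); last exact/funext.
  by apply: measurable_sum => k; apply: measurable_funM => //; exact: measurable_indic.
have phi0 w : 0 <= phi w by rewrite divr_ge0// ltW.
have Ephi : ('E_P[phi] = mean%:E)%E.
  rewrite unlock; under eq_integral do rewrite phiE -sumEFin.
  rewrite (ge0_integral_sum P measurableT) => [|k|k w _]; last 2 first.
    by apply/measurable_EFinP; apply: measurable_funM => //; exact: measurable_indic.
    by rewrite lee_fin mulr_ge0// divr_ge0// ltW.
  rewrite -sumEFin; apply: eq_bigr => k _.
  under eq_integral do rewrite EFinM.
  rewrite (ge0_integralZl P measurableT) => [||w _|]; last 3 first.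
    by apply/measurable_EFinP; exact: measurable_indic.
    by rewrite lee_fin.
    by rewrite lee_fin divr_ge0// ltW.
  by rewrite integral_indic// setIT muleC [in RHS]EFinM fineK// fin_num_measure.
have E1 : ('E_P[phi] <= 'E_P[X])%E.
  apply: expectation_le => //.
  apply: filterS Xb => w Xw.
  by have /andP[] := digit_approx L0 (introT andP (conj (X0 w) Xw)).
have E2 : ('E_P[X] <= 'E_P[(phi \+ cst L%:R^-1)%R])%E.
  apply: expectation_le => //.
  - exact: measurable_funD.
  - by move=> w /=; rewrite addr_ge0// invr_ge0 ltW.
  apply: filterS Xb => w Xw.
  by have /andP[] := digit_approx L0 (introT andP (conj (X0 w) Xw)).
have E3 : ('E_P[(phi \+ cst L%:R^-1)%R] = 'E_P[phi] + (L%:R^-1)%:E)%E.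
  rewrite -[X in (_ + X)%E](expectation_cst P) unlock.
  under eq_integral do rewrite EFinD.
  rewrite (ge0_integralD P measurableT)//.
  + by move=> w _; rewrite lee_fin.
  + exact/measurable_EFinP.
  + by move=> w _; rewrite lee_fin invr_ge0 ltW.
  + by apply/measurable_EFinP; exact: measurable_cst.
(* The finite bounds exclude an infinite expectation, for which [fine] would return a default
   value. *)
move: E1 E2; rewrite E3 Ephi; case: ('E_P[X])%E => [e| |]//.
by rewrite -EFinD !lee_fin /= => -> ->.
Qed.

(** * Deviation of the scaled matrix *)

(** The three error terms come from the tail bound on the grid, the rounding of test vectors and the
    rounding of entries. The event [G] depends on the digits only; the almost sure bound by [b]
    remains a pointwise condition on [w]. *)
Lemma bilin_concentration (R : realType) (d : measure_display)
    (T : measurableType d) (P : probability T R) (m n H L : nat)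
    (X : 'I_m -> 'I_n -> {RV P >-> R}) (b t : R) :
  (0 < H)%N -> (0 < L)%N -> 0 < b -> 0 <= t ->
  mutually_independent (fun ij : 'I_m * 'I_n => X ij.1 ij.2) ->
  (forall i j w, 0 <= X i j w) -> (forall i j, {ae P, forall w, X i j w <= b}) ->
  exists2 G, measurable G /\
    (P (~` G) <= ((2 * H.+1)%:R ^+ (m + n) * expR (- (t ^+ 2 / (8 * b ^+ 2))))%:E)%E &
    forall w, G w -> (forall i j, X i j w <= b) ->
    bilin_le (sample_mx X w - expect_mx X)
      (t + 2 * b * ((m * n)%:R / H%:R) + L%:R^-1 * Num.sqrt (m * n)%:R).
Proof.
move=> H0 L0 b0 t0 indX X0 Xb; have Lp : 0 < L%:R :> R by rewrite ltr0n.
pose I := ('I_m * 'I_n)%type; pose K := 'I_(Num.truncn (b * L%:R)).+1.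
pose p (ij : I) (k : K) := digit_pmf (X ij.1 ij.2) k.
have p0 ij k : 0 <= p ij k by rewrite fine_ge0.
have p1 ij : \sum_k p ij k = 1 by exact: digit_pmf_sum.
pose mu (ij : I) := digit_mean (X ij.1 ij.2) b L.
pose y ij (k : K) : R := k%:R / L%:R - mu ij.
have val0 (k : K) : 0 <= k%:R / L%:R :> R by rewrite divr_ge0// ltW.
have valb (k : K) : k%:R / L%:R <= b by apply: digit_le => //; exact: ltW.
have mu0 ij : 0 <= mu ij.
  by apply: sumr_ge0 => k _; exact: (mulr_ge0 (p0 ij k) (val0 k)).
have mub ij : mu ij <= b.
  rewrite -[leRHS]mul1r -(p1 ij) mulr_suml; apply: ler_sum => k _.
  exact: (ler_wpM2l (p0 ij k) (valb k)).
have py ij : \sum_k p ij k * y ij k = 0.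
  under eq_bigr do rewrite mulrBr.
  rewrite sumrB -mulr_suml p1 mul1r; exact: subrr.
have yb ij k : `|y ij k| <= b.
  have := val0 k; have := valb k; have := mu0 ij; have := mub ij; rewrite /y.
  move: (k%:R / L%:R : R) => z *.
  by rewrite ler_norml; apply/andP; split; lra.
pose bad (v : {ffun I -> K}) := [exists gh : grid m H * grid n H,
      [&& in_ball R gh.1, in_ball R gh.2 &
          t < \sum_ij grid_val R (gh.1 ij.1) * grid_val R (gh.2 ij.2) * y ij (v ij)]].
pose D w : {ffun I -> K} := [ffun ij => digit b L (X ij.1 ij.2 w)].
have [mS PS] := prob_digits bad indX (fun k => measurable_digit k L0).
exists (~` [set w | bad (D w)]).
  split; first exact: measurableC.
  by rewrite setCK PS lee_fin; exact: (@net_tail R m n H K p y b t).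
move=> w /= /negP nbad Xwb.
(* [B] is the centred rounded matrix; what remains has entries at most [1/L], as value and mean are
   both rounded down by at most that much. *)
pose B : 'M[R]_(m, n) := \matrix_(i, j) y (i, j) (D w (i, j)).
rewrite (_ : _ - _ = B + (sample_mx X w - expect_mx X - B)); last first.
  by rewrite addrCA subrr addr0.
apply: bilin_leD.
  apply: bilin_le_net => // [i j|g h gb hb]; first by rewrite mxE.
  move: nbad; rewrite /bad negb_exists => /forallP/(_ (g, h)).
  rewrite /= gb hb/= -leNgt; apply: le_trans.
  rewrite pair_big le_eqVlt; apply/orP; left; apply/eqP; apply: eq_bigr => -[i j] _.
  by rewrite mxE.
apply: bilin_le_entry => i j; rewrite !mxE ffunE /=.
have X0b : 0 <= X i j w <= b by rewrite X0 Xwb.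
have /andP[h1 h2] := digit_approx L0 X0b.
have /andP[h3 h4] := digit_mean_approx L0 (X0 i j) (Xb i j).
have lin (u z s E v : R) : z <= u -> u <= z + s -> v <= E -> E <= v + s ->
    `|u - E - (z - v)| <= s.
  by move=> *; rewrite ler_norml; apply/andP; split; lra.
exact: lin.
Qed.

Lemma opnorm2N (R : realType) (m n : nat) (B : 'M[R]_(m, n)) :
  opnorm2 (- B) <= opnorm2 B.
Proof.
by apply: opnorm2_le; [exact: opnorm2_ge0|apply/bilin_le_opp/opnorm2_bilin_le].
Qed.

Lemma entry_ratio_spread (R : realType) (n : nat) (v : 'rV[R]_n) (C : R) :
  (0 < n)%N -> positive_mx v -> max_entry v / min_entry v <= C ->
  0 < C /\ forall i k, v 0 i <= C * v 0 k.
Proof.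
move=> n0 v0 vC; pose i0 := Ordinal n0.
have [a a0 av] := positive_lower_bound (v0 0).
have [b b0 bv] := positive_upper_bound (v0 0).
have maxv i : v 0 i <= max_entry v.
  by apply: ub_le_sup; [exists b => _ [k _ <-]|exists i].
have minv k : min_entry v <= v 0 k.
  by apply: ge_inf; [exists a => _ [i _ <-]|exists k].
have min0 : 0 < min_entry v.
  apply: (lt_le_trans a0); apply: lb_le_inf; first by exists (v 0 i0), i0.
  by move=> _ [i _ <-].
have max0 : 0 < max_entry v by apply: lt_le_trans (maxv i0).
have C0 : 0 < C by apply: lt_le_trans vC; exact: divr_gt0.
split=> // i k; apply: (le_trans (maxv i)).
move: vC; rewrite ler_pdivrMr// => /le_trans; apply.
by rewrite ler_pM2l.
Qed.

Lemma expectation_between (R : realType) (d : measure_display)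
    (T : measurableType d) (P : probability T R) (X : {RV P >-> R}) (a b : R) :
  0 <= a -> 0 <= b -> (forall w, 0 <= X w) ->
  {ae P, forall w, a <= X w <= b} -> a <= fine ('E_P[X])%E <= b.
Proof.
move=> a0 b0 X0 Xab.
have h1 : ('E_P[cst a] <= 'E_P[X])%E.
  by apply: expectation_le => //; apply: filterS Xab => w /andP[].
have h2 : ('E_P[X] <= 'E_P[cst b])%E.
  by apply: expectation_le => //; apply: filterS Xab => w /andP[].
move: h1 h2; rewrite !expectation_cst; case: ('E_P[X])%E => //= e.
by rewrite !lee_fin => -> ->.
Qed.

(** By continuity of the scaling, the complement is open in terms of the sampled entries. *)
Lemma measurable_scaling_deviation (R : realType) (d : measure_display)
    (T : measurableType d) (P : probability T R) (m n : nat)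
    (X : 'I_m -> 'I_n -> {RV P >-> R}) (r : 'rV[R]_m) (c : 'rV[R]_n)
    (Q : T -> 'M[R]_(m, n)) (Q0 : 'M[R]_(m, n)) (t : R) :
  (0 < m)%N -> (0 < n)%N -> (forall w, positive_mx (sample_mx X w)) ->
  positive_mx r -> positive_mx c ->
  (forall w, is_scaling_of (sample_mx X w) r c (Q w)) ->
  measurable [set w | opnorm2 (Q w - Q0) <= t].
Proof.
move=> m0 n0 X0 r0 c0 XQ.
rewrite (_ : [set w | _] = ~` [set w | t < opnorm2 (Q w - Q0)]); last first.
  by apply/seteqP; split => w /=; rewrite leNgt => /negP.
apply: measurableC; apply: (measurable_sample_open (X := X)) => w /= tw.
(* Half the gap: moving [Q] by at most this much keeps the deviation above [t]. *)
pose eps := (opnorm2 (Q w - Q0) - t) / 2.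
have eps0 : 0 < eps by rewrite divr_gt0// subr_gt0.
have [dl dl0 h] := scaling_continuous m0 n0 (X0 w) r0 c0 (XQ w) eps0.
exists dl => // w' w'w.
have : opnorm2 (Q w' - Q w) <= eps.
  by apply: (h _ _ (XQ w')) => i j; rewrite !mxE.
have := opnorm2D (- (Q w' - Q w)) (Q w' - Q0).
rewrite opprB addrA subrK => h1 h2.
have := opnorm2N (Q w' - Q w); rewrite opprB => h3.
move: h1 h2 h3 tw; rewrite /eps; clear.
move: (opnorm2 _) (opnorm2 _) (opnorm2 _) (opnorm2 _) => *; lra.
Qed.

(** The explicit estimate at one size: with [h] the larger dimension, failure has probability at
    most [1/h]. *)
Lemma whp_scaling_deviation (R : realType) (d : measure_display)
    (T : measurableType d) (P : probability T R) (m n : nat)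
    (X : 'I_m -> 'I_n -> {RV P >-> R}) (r : 'rV[R]_m) (c : 'rV[R]_n)
    (Q : T -> 'M[R]_(m, n)) (Q0 : 'M[R]_(m, n)) (a b C : R) :
  (0 < m)%N -> (0 < n)%N -> (2 <= maxn m n)%N -> 0 < a -> 0 < b -> 0 < C ->
  (forall w, positive_mx (sample_mx X w)) -> positive_mx r -> positive_mx c ->
  (forall w, is_scaling_of (sample_mx X w) r c (Q w)) ->
  is_scaling_of (expect_mx X) r c Q0 ->
  mutually_independent (fun ij : 'I_m * 'I_n => X ij.1 ij.2) ->
  (forall i j, {ae P, forall w, a <= X i j w <= b}) ->
  (forall i k, r 0 i <= C * r 0 k) -> (forall j k, c 0 j <= C * c 0 k) ->
  ((1 - (maxn m n)%:R^-1)%:E <=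
   P [set w | (opnorm2 (Q w - Q0) / opnorm2 Q0 <=
               scaling_const a b C * (11 * b + 1) *
               Num.sqrt (ln (maxn m n)%:R / (minn m n)%:R))%R] <= 1)%E.
Proof.
move=> m0 n0 h2 a0 b0 C0 X0 r0 c0 XQ EQ indX Xab rC cC; set h := maxn m n.
have Xpos i j w : 0 < X i j w by have := X0 w i j; rewrite mxE.
have Xge0 i j w : 0 <= X i j w := ltW (Xpos i j w).
have hp : 0 < h%:R :> R by rewrite ltr0n (leq_trans _ h2).
have h1 : 1 < h%:R :> R by rewrite ltr1n.
pose ell : R := ln h%:R; pose sq := Num.sqrt (h%:R * ell).
(* From [h ln h >= h - 1]; it lets additive constants be absorbed into [sq]. *)
have hell : 1 <= h%:R * ell.
  apply: le_trans (ln_ge_1sub hp); rewrite lerBrDr -[1 + 1]/(2%:R).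
  by rewrite ler_nat.
have sq1 : 1 <= sq by rewrite -sqrtr1 ler_sqrt// (le_trans _ hell).
have sq0 : 0 < sq by apply: lt_le_trans sq1.
have sqq : sq ^+ 2 = h%:R * ell by rewrite sqr_sqrtr// (le_trans _ hell).
(* With 9 the tail exponent is [81/8 * h ln h], which beats the [8 * h ln h] of the grid count and
   leaves at least [ln h]. *)
pose t := 9 * b * sq; have t0 : 0 <= t by rewrite !mulr_ge0// ltW.
have H0 : (0 < h ^ 2)%N by rewrite expn_gt0 (leq_trans _ h2).
have L0 : (0 < h)%N by apply: leq_trans h2.
have mnh : (m * n <= h ^ 2)%N by rewrite -mulnn leq_mul ?leq_maxl ?leq_maxr.
have Xb i j : {ae P, forall w, X i j w <= b}.
  by apply: filterS (Xab i j) => w /andP[].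
have [G [mG PG] GB] := bilin_concentration H0 L0 b0 t0 indX Xge0 Xb.
(* Grid step [1/h^2] and digit step [1/h] give errors at most [2 b] and 1, added to the [9 b] of
   [t]. *)
pose e := (11 * b + 1) * sq; have e0 : 0 <= e.
  by rewrite mulr_ge0 ?(ltW sq0)// addr_ge0// mulr_ge0// ltW.
have eG : t + 2 * b * ((m * n)%:R / (h ^ 2)%:R) + h%:R^-1 * Num.sqrt (m * n)%:R <= e.
  have q1 : (m * n)%:R / (h ^ 2)%:R <= 1 :> R.
    by rewrite ler_pdivrMr ?ltr0n// mul1r ler_nat.
  have q2 : h%:R^-1 * Num.sqrt (m * n)%:R <= 1 :> R.
    rewrite mulrC ler_pdivrMr// mul1r -[leRHS]gtr0_norm// -sqrtr_sqr ler_sqrt ?sqr_ge0//.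
    by rewrite -natrX ler_nat.
  have q3 := ler_wpM2l (ltW b0) q1; have q4 := ler_wpM2l (ltW b0) sq1.
  by rewrite /e /t; lra.
have tail : (2 * (h ^ 2).+1)%:R ^+ (m + n) * expR (- (t ^+ 2 / (8 * b ^+ 2)))
    <= h%:R^-1 :> R.
  (* That is, [2 (h^2 + 1) <= h^4], valid for [h >= 2]. *)
  have k1 : (2 * (h ^ 2).+1)%:R <= expR (4 * ell) :> R.
    rewrite -[X in X * ell]/(4%:R) expRM_natl lnK ?posrE// -natrX ler_nat.
    have : (2 ^ 2 <= h ^ 2)%N by rewrite leq_sqr.
    rewrite -[4%N]/(2 * 2)%N expnM; move: (h ^ 2)%N; clear => u; nia.
  have k2 : (2 * (h ^ 2).+1)%:R ^+ (m + n) <= expR (8 * (h%:R * ell)) :> R.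
    apply: (@le_trans _ _ (expR (4 * ell) ^+ (m + n))).
      by rewrite lerXn2r ?nnegrE ?expR_ge0.
    rewrite -expRM_natl ler_expR.
    have : (m + n)%:R <= 2 * h%:R :> R.
      by rewrite -natrM ler_nat mul2n -addnn leq_add ?leq_maxl ?leq_maxr.
    have ell0 : 0 <= ell by rewrite ln_ge0// ltW.
    nra.
  have -> : t ^+ 2 / (8 * b ^+ 2) = 81 / 8 * (h%:R * ell).
    by rewrite /t exprMn sqq; field; rewrite gt_eqF.
  apply: (le_trans (ler_wpM2r (expR_ge0 _) k2)).
  rewrite -expRD -[leRHS]lnK ?posrE ?invr_gt0// lnV ?posrE// ler_expR -/ell.
  have : ell <= h%:R * ell by rewrite ler_peMl ?ln_ge0// ltW.
  lra.
have [E [mE PE EX]] : {ae P, forall w, forall i j, a <= X i j w <= b}.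
  by apply: filter_forall => i; apply: filter_forall.
have r1 : 0 < \sum_k r 0 k.
  by rewrite (bigD1 (Ordinal m0))//= ltr_pwDl// sumr_ge0// => k _; exact: ltW.
have mn0 : 0 < m%:R * n%:R :> R by rewrite mulr_gt0 ?ltr0n.
have Q00 : 0 < opnorm2 Q0.
  rewrite -(@pmulr_lgt0 _ (Num.sqrt (m%:R * n%:R))) ?sqrtr_gt0//.
  exact: lt_le_trans (opnorm2_scaling_ge EQ).
set A := [set w | _].
have mA : measurable A.
  rewrite /A; under eq_set do rewrite ler_pdivrMr//.
  exact: measurable_scaling_deviation XQ.
(* A large deviation requires either failure of the concentration event or a sample in the null set
   [E] that covers all violations of the entry bounds. *)
have sub : ~` A `<=` ~` G `|` E.
  move=> w nA; have [Gw|nG] := pselect (G w); last by left.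
  right; apply: EX => Xw; apply: nA; rewrite /A /=.
  have Xwb i j : a <= sample_mx X w i j <= b by rewrite mxE.
  have Exb i j : a <= expect_mx X i j <= b.
    by rewrite mxE; apply: expectation_between => //; exact: ltW.
  have Be : bilin_le (sample_mx X w - expect_mx X) e.
    have Xwb' i j : X i j w <= b by have /andP[] := Xw i j.
    move=> p q; apply: (le_trans (GB w Gw Xwb' p q)).
    by rewrite ler_wpM2r// mulr_ge0 ?euclid_ge0.
  apply: (le_trans (scaling_relative_stability m0 n0 a0 b0 C0 e0 Exb Xwb rC cC
    r0 EQ (XQ w) Be)).
  rewrite -[leRHS]mulrA ler_wpM2l ?scaling_const_ge0 ?(ltW a0) ?(ltW b0)//.
  rewrite /e -mulrA le_eqVlt; apply/orP; left; apply/eqP; congr (_ * _).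
  (* Writing [m n] as maximum times minimum cancels [h] under the roots and leaves [ln h] over the
     minimum. *)
  have -> : m%:R * n%:R = h%:R * (minn m n)%:R :> R.
    by rewrite -!natrM /h; case: (leqP m n) => // _; rewrite mulnC.
  rewrite /sq (@sqrtrM _ h%:R ell) ?(@sqrtrM _ h%:R (minn m n)%:R) ?(ltW hp)//.
  rewrite -mulf_div divff ?mul1r ?gt_eqF ?sqrtr_gt0//.
  by rewrite sqrtrM ?sqrtrV// ln_ge0// ltW.
have PA : (P (~` A) <= (h%:R^-1)%:E)%E.
  apply: (@le_trans _ _ (P (~` G `|` E))).
    apply: le_measure; rewrite ?inE//; first exact: measurableC.
    by apply: measurableU => //; exact: measurableC.
  apply: (le_trans (measureU2 P (measurableC mG) mE)).
  by rewrite [X in (_ + X)%E](_ : _ = 0%E) ?adde0 ?(le_trans PG)// lee_fin.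
apply/andP; split; last exact: probability_le1.
rewrite -[A]setCK probability_setC; last exact: measurableC.
by rewrite EFinB leeB.
Qed.

Theorem corollary7 (R : realType) (N0 : nat) (M : nat -> nat)
  (d : nat -> measure_display) (T : forall N : nat, measurableType (d N))
  (Pr : forall N : nat, probability (T N) R)
  (r : forall N : nat, 'rV[R]_(M N)) (c : forall N : nat, 'rV[R]_N)
  (At : forall N : nat, 'I_(M N) -> 'I_N -> {RV (Pr N) >-> R})
  (Pt : forall N : nat, T N -> 'M[R]_(M N, N))
  (P : forall N : nat, 'M[R]_(M N, N))
  (a b C : R)
  (hN0 : (0 < N0)%N)
  (hM : forall N : nat, (N0 <= N)%N -> (0 < M N)%N)
  (hMoo : M N @[N --> \oo] --> \oo)
  (hr : forall N : nat, (N0 <= N)%N -> positive_mx (r N))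
  (hc : forall N : nat, (N0 <= N)%N -> positive_mx (c N))
  (hrc : forall N : nat, (N0 <= N)%N -> l1norm (r N) = l1norm (c N))
  (hApos : forall N : nat, (N0 <= N)%N ->
     forall w : T N, positive_mx (sample_mx (At N) w))
  (hPt : forall N : nat, (N0 <= N)%N ->
     forall w : T N, is_scaling_of (sample_mx (At N) w) (r N) (c N) (Pt N w))
  (hP : forall N : nat, (N0 <= N)%N ->
     is_scaling_of (expect_mx (At N)) (r N) (c N) (P N))
  (hindep : forall N : nat, (N0 <= N)%N ->
     mutually_independent (fun ij : 'I_(M N) * 'I_N => At N ij.1 ij.2))
  (ha : 0 < a) (hb : 0 < b)
  (hab : forall N : nat, (N0 <= N)%N -> forall (i : 'I_(M N)) (j : 'I_N),
     {ae Pr N, forall w : T N, a <= At N i j w <= b})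
  (hrC : forall N : nat, (N0 <= N)%N -> max_entry (r N) / min_entry (r N) <= C)
  (hcC : forall N : nat, (N0 <= N)%N -> max_entry (c N) / min_entry (c N) <= C) :
  bigO_whp Pr
    (fun (N : nat) (w : T N) => opnorm2 (Pt N w - P N) / opnorm2 (P N))
    (fun N : nat => Num.sqrt (ln (maxn (M N) N)%:R / (minn (M N) N)%:R)).
Proof.
exists (scaling_const a b C * (11 * b + 1)).
(* The lower bound [1 - 1/h] with [h >= N] is weakened by [1/N <= 2/(N+1)], to fit the harmonic
   sequence. *)
apply: (@squeeze_cvge _ _ _ _ (fun N => (1 - 2 * N.+1%:R^-1)%:E) _ (fun=> 1%E)).
- exists (maxn N0 2) => // N /=; rewrite geq_max => /andP[N0N N2].
  have M0 := hM N N0N; have Np : (0 < N)%N by apply: leq_trans N2.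
  have [C0 rC] := entry_ratio_spread M0 (hr N N0N) (hrC N N0N).
  have [_ cC] := entry_ratio_spread Np (hc N N0N) (hcC N N0N).
  have max2 : (2 <= maxn (M N) N)%N by rewrite (leq_trans N2)// leq_maxr.
  have /andP[low up] := whp_scaling_deviation M0 Np max2 ha hb C0 (hApos N N0N) (hr N N0N)
    (hc N N0N) (hPt N N0N) (hP N N0N) (hindep N N0N) (hab N N0N) rC cC.
  apply/andP; split; last exact: up.
  apply: le_trans low; rewrite lee_fin lerD2l lerN2.
  apply: (@le_trans _ _ N%:R^-1).
    by rewrite lef_pV2 ?posrE ?ltr0n ?(leq_trans Np) ?leq_maxr// ler_nat leq_maxr.
  rewrite ler_pdivlMr ?ltr0n// mulrC ler_pdivrMr ?ltr0n// -natrM ler_nat.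
  by rewrite mul2n -addnn -[X in (X < _)%N]addn0 ltn_add2l.
- apply/cvg_EFin; first by near=> N.
  rewrite -[X in _ --> X]subr0 -[X in _ - X](mulr0 (2 : R)).
  apply: cvgB; first exact: cvg_cst.
  by apply: cvgM; [exact: cvg_cst|exact: cvg_harmonic].
- exact: cvg_cst.
Unshelve. all: by end_near.
Qed.
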